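(* For each $n$ let $U_n$ be a random $n\times n$ unitary matrix distributed according to the normalized Haar measure on $U(n)$ (the Circular Unitary Ensemble), with eigenvalues $e^{i\theta_j}$, $0\le\theta_j<2\pi$, $j=1,\dots,n$, and let $$N_n(\Delta)=\frac1n\#\{j:\theta_j\in\Delta\},\qquad \Delta\subset[0,2\pi)\ \text{Borel}.$$ Then as $n\to\infty$ the eigenvalue counting measures $N_n$ converge weakly in probability to the uniform measure on the unit circle, i.e. to the measure $\Delta\mapsto|\Delta|/2\pi$ on $[0,2\pi)$.
   Context: $|\Delta|$ denotes Lebesgue measure, and $[0,2\pi)$ is identified with the unit circle via $\theta\mapsto e^{i\theta}$. Weak convergence in probability of random measures $N_n$ to a nonrandom measure $N$ means that $\int\varphi\,dN_n\to\int\varphi\,dN$ in probability for each continuous function $\varphi$ on the circle. The matrices for different $n$ may be realized on any common probability space, for example the product over $n$ of the groups $U(n)$ with Haar measures. *)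

(* Defs.v *)
From HB Require Import structures.
From mathcomp Require Import all_boot all_order all_algebra spectral.
From mathcomp Require Import all_classical all_reals all_analysis.
From mathcomp Require Import complex.

Set Implicit Arguments.
Unset Strict Implicit.
Unset Printing Implicit Defensive.

Import Order.TTheory GRing.Theory Num.Theory.
Import numFieldNormedType.Exports.

Local Open Scope classical_set_scope.
Local Open Scope ring_scope.

(* Topology of the complex modulus; it induces the usual (entrywise) topology
   on 'M[R[i]]_n. *)
HB.instance Definition _ (R : realType) :=
  PseudoPointedMetric.copy R[i] R[i]^o.

Section circle.
Context {R : realType}.

Definition expi (t : R) : R[i] := (cos t +i* sin t)%C.

Definition unit_circle : set R[i] := [set z | `|z| = 1].

Definition angles : set (measurableTypeR R) := `[0, 2 * pi[.

Lemma measurable_angles : measurable angles.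
Proof. exact: measurable_itv. Qed.

Lemma inv_2pi_ge0 : 0 <= (2 * pi : R)^-1.
Proof. by rewrite invr_ge0 mulr_ge0// pi_ge0. Qed.

Definition uniform_circle : {measure set (measurableTypeR R) -> \bar R} :=
  mscale (NngNum inv_2pi_ge0) (mrestr lebesgue_measure measurable_angles).

End circle.

Section unitary_group.
Variables (R : realType) (n : nat).

(* The carrier is the set-type of the set of unitary matrices, so that it gets
   the topology induced by 'M[R[i]]_n. *)
Definition unitary : Type :=
  [set A : 'M[R[i]]_n | A \is unitarymx].

HB.instance Definition _ := Topological.on unitary.

Definition unitary_mx (V : unitary) : 'M[R[i]]_n := set_val V.

Lemma unitary_mxP (V : unitary) : unitary_mx V \is unitarymx.
Proof. exact: (set_valP V). Qed.

Lemma unitary1_subproof :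
  (1%:M : 'M[R[i]]_n) \in [set A : 'M[R[i]]_n | A \is unitarymx].
Proof.
by apply/mem_set/unitarymxP; rewrite trmx1 map_mx1 mulmx1.
Qed.

Definition unitary1 : unitary := exist (fun A => A \in _) _ unitary1_subproof.

HB.instance Definition _ := isPointed.Build unitary unitary1.

Lemma unitary_mul_subproof (V W : unitary) :
  unitary_mx V *m unitary_mx W \in [set A : 'M[R[i]]_n | A \is unitarymx].
Proof. by apply/mem_set/mul_unitarymx; exact: unitary_mxP. Qed.

Definition unitary_mul (V W : unitary) : unitary :=
  exist (fun A => A \in _) _ (unitary_mul_subproof V W).

Definition borel_unitary := g_sigma_algebraType (@open unitary).

(* On a compact group a left-invariant Borel probability measure is unique, and
   it is then right-invariant as well. *)
Definition is_haar (mu : probability borel_unitary R) :=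
  forall (V : borel_unitary) (A : set borel_unitary), measurable A ->
    mu [set unitary_mul V W | W in A] = mu A.

End unitary_group.

Section counting_measure.
Context {R : realType} {n : nat}.
Variable theta : 'I_n -> R.

Definition counting_measure (D : set (measurableTypeR R)) : \bar R :=
  (n%:R^-1 * #|[pred j | theta j \in D]|%:R)%:E.

Let inv_n_ge0 : 0 <= n%:R^-1 :> R.
Proof. by rewrite invr_ge0. Qed.

Let mu_dirac (k : nat) : {measure set (measurableTypeR R) -> \bar R} :=
  if insub k is Some j then dirac (theta j : measurableTypeR R) else mzero.

Let counting_measureE :
  counting_measure = mscale (NngNum inv_n_ge0) (msum mu_dirac n).
Proof.
apply/funext => D; rewrite /counting_measure /mscale /msum /= EFinM.
congr (_ * _)%E; rewrite -sum1_card natr_sum -sumEFin big_mkcond/=.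
apply: eq_bigr => j _; rewrite /mu_dirac valK /= inE diracE.
by case: (theta j \in D).
Qed.

Let counting_measure0 : counting_measure set0 = 0%E.
Proof. by rewrite counting_measureE measure0. Qed.

Let counting_measure_ge0 D : (0 <= counting_measure D)%E.
Proof. by rewrite counting_measureE measure_ge0. Qed.

Let counting_measure_sigma_additive : semi_sigma_additive counting_measure.
Proof. by rewrite counting_measureE; exact: measure_semi_sigma_additive. Qed.

HB.instance Definition _ := isMeasure.Build _ _ _ counting_measure
  counting_measure0 counting_measure_ge0 counting_measure_sigma_additive.

End counting_measure.

(* t lists, with algebraic multiplicity, the eigenangles of V in [0, 2 pi). *)
Definition is_eigenangles (R : realType) (n : nat) (V : unitary R n)
    (t : 'I_n -> R) :=
  (forall j, 0 <= t j < 2 * pi) /\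
  char_poly (unitary_mx V) = \prod_(j < n) ('X - (expi (t j))%:P).

Section convergence.
Context d {Omega : measurableType d} {R : realType}.
Variable P : probability Omega R.

(* Measurability is part of the notion: P is only meaningful on events. *)
Definition cvg_in_probability (X : nat -> Omega -> R) (l : R) :=
  (forall n, measurable_fun setT (X n)) /\
  (forall e : R, 0 < e ->
    P [set w | e < `|X n w - l|] @[n --> \oo] --> 0%E).

(* Measures on the circle are carried by [0, 2 pi) through t |-> expi t; a test
   function is continuous on the circle, not merely on [0, 2 pi). *)
Definition cvg_weakly_in_probability
    (N : nat -> Omega -> {measure set (measurableTypeR R) -> \bar R})
    (nu : {measure set (measurableTypeR R) -> \bar R}) :=
  forall phi : R[i] -> R, {within unit_circle, continuous phi} ->
    cvg_in_probability
      (fun n w => Rintegral (N n w) angles (fun t => phi (expi t)))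
      (Rintegral nu angles (fun t => phi (expi t))).

End convergence.

(* Main.v *)
Require Import Defs.
From HB Require Import structures.
From mathcomp Require Import all_boot all_order all_algebra spectral.
From mathcomp Require Import all_classical all_reals all_analysis.
From mathcomp Require Import complex measurable_realfun ring lra.

(** The k-th Fourier coefficient of the eigenvalue counting measure of a unitary
    matrix U is (1/n) tr U^k, so the theorem says that these coefficients tend to
    0 in probability for k >= 1.  In fact E |tr U^k|^2 <= 2^k, whatever n is
    ([power_moment_le]), so that (1/n) tr U^k is of order 1/n in L^2.

    The moment bound comes from the invariance of Haar measure.  For an
    infinitesimal left translation U -> U + tXU, with X running through the matrix
    units E_ab, the mean of the derivative of (U^k)_ab conj(tr U^k) vanishes;
    summing over a and b gives the loop equation ([loop_equation])
      sum_(l < k) E [tr U^l tr U^(k-l) conj(tr U^k)] = k n.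
    Its term l = 0 is n E |tr U^k|^2.  Since |tr U^k| <= n, the inequality between
    geometric and arithmetic means bounds each other term by n times a mean of
    lower moments, and after division by n,
      E |tr U^k|^2 <= k + sum_(0 < l < k) E |tr U^l|^2,
    which gives 2^k - 1 by induction.

    No derivative of an expectation is taken.  For a Hermitian projection P and
    |z| = 1 the matrix 1 + (z - 1)P is unitary, and the function considered above,
    evaluated at (1 + (z - 1)P)U, is a trigonometric polynomial in z of degree at
    most k.  Its angular derivative at z = 1 is then a fixed linear combination
    of its values at the (2k+1)-th roots of unity, M. Riesz' interpolation formula
    ([riesz_deriv]).  The weights add up to 0, since constants have derivative 0,
    and all these values have the same mean by invariance; so the derivative has
    mean 0 ([expectC_loop_term_proj]).  Projections span all matrices by
    polarization ([delta_mx_herm_proj_span]), and the identity is linear in the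
    direction.

    A continuous function on the circle is a uniform limit of trigonometric
    polynomials ([trig_approx], by a Fejer kernel averaged over a grid of roots of
    unity).  For those, Chebyshev's inequality and the moment bound give the
    convergence ([deviation_prob]).  As the eigenangles are given pointwise,
    measurability of a linear statistic is also obtained in this way: for a
    trigonometric polynomial it is a continuous function of the matrix, through
    the traces of its powers, and the general case is a limit of this one
    ([stat_measurable]). *)

Set Implicit Arguments.
Unset Strict Implicit.
Unset Printing Implicit Defensive.

Import Order.TTheory GRing.Theory Num.Theory.
Import numFieldNormedType.Exports.

Local Open Scope classical_set_scope.
Local Open Scope ring_scope.

Local Notation Re := complex.Re.
Local Notation Im := complex.Im.

(** * M. Riesz' interpolation at roots of unity *)

Section riesz.
Local Open Scope sesquilinear_scope.
Variable C : numClosedFieldType.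

Lemma sum_expr_unity_root N (x : C) : x ^+ N = 1 ->
  \sum_(j < N) x ^+ j = if x == 1 then N%:R else 0.
Proof.
case: eqP => [->|/eqP x1] xN.
  by rewrite (eq_bigr (fun=> 1)) => [|j _]; rewrite ?expr1n// sumr_const card_ord.
have /eqP := subrX1 x N; rewrite xN subrr eq_sym mulf_eq0 subr_eq0 (negbTE x1) /=.
by move/eqP.
Qed.

Lemma prim_root_norm N (w : C) : N.-primitive_root w -> `|w| = 1.
Proof.
move=> wN; have N0 := prim_order_gt0 wN; apply/eqP.
by rewrite -(@pexpr_eq1 _ _ N) // -normrX (prim_expr_order wN) normr1.
Qed.

Lemma sum_prim_root N (w : C) i m : N.-primitive_root w ->
  \sum_(j < N) (w ^+ j) ^+ i * ((w ^+ j) ^+ m)^-1 =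
  if i == m %[mod N] then N%:R else 0.
Proof.
move=> wN; have w0 : w != 0 by rewrite -normr_eq0 (prim_root_norm wN) oner_eq0.
have wU : forall a, w ^+ a \is a GRing.unit by move=> a; rewrite unitfE expf_neq0.
rewrite (eq_bigr (fun j : 'I_N => (w ^+ i / w ^+ m) ^+ j)); last first.
  by move=> j _; rewrite expr_div_n -!exprM !(mulnC j).
rewrite sum_expr_unity_root; last first.
  have wNa a : (w ^+ a) ^+ N = 1.
    by rewrite exprAC (prim_expr_order wN) expr1n.
  by rewrite expr_div_n !wNa divr1.
by rewrite -(inj_eq (mulIr (wU m))) mulrVK// mul1r (eq_prim_root_expr wN).
Qed.

(** Written out, the weight is (1/N) sum_(|p| <= k) p w^(-jp) with N = 2k+1 and
    p = m - k, that is, the function p on [-k, k] expanded on the characters of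
    Z/N. *)
Definition riesz_weight k (w : C) (j : nat) : C :=
  (k.*2.+1)%:R^-1 * \sum_(m < k.*2.+1) (m%:R - k%:R) * ((w ^+ j) ^+ k / (w ^+ j) ^+ m).

(** On the circle the monomial product is z^(a-b) with |a-b| <= k, and orthogonality
    of the characters of Z/(2k+1) selects the single term p = a - b of the weight. *)
Lemma riesz_weightE k (w : C) a b : (k.*2.+1).-primitive_root w ->
  (a <= k)%N -> (b <= k)%N ->
  \sum_(j < k.*2.+1) riesz_weight k w j * ((w ^+ j) ^+ a * ((w ^+ j) ^+ b)^*)
  = a%:R - b%:R.
Proof.
move=> wN ak bk; set N := k.*2.+1.
have w1 j : `|w ^+ j| = 1 by rewrite normrX (prim_root_norm wN) expr1n.
have w0 j : w ^+ j != 0 by rewrite -normr_eq0 w1 oner_eq0.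
have bkN : (a + (k - b) < N)%N.
  by rewrite /N ltnS -addnn leq_add// leq_subr.
transitivity (N%:R^-1 * \sum_(m < N) (m%:R - k%:R : C) *
   \sum_(j < N) (w ^+ j) ^+ (a + (k - b)) / (w ^+ j) ^+ m).
  rewrite mulr_sumr [RHS](eq_bigr (fun m : 'I_N => \sum_(j < N) N%:R^-1 *
     ((m%:R - k%:R) * ((w ^+ j) ^+ (a + (k - b)) / (w ^+ j) ^+ m)))); last first.
    by move=> m _; rewrite mulr_sumr mulr_sumr.
  rewrite exchange_big; apply: eq_bigr => j _; rewrite /riesz_weight -/N.
  rewrite mulr_sumr mulr_suml; apply: eq_bigr => m _.
  have -> : ((w ^+ j) ^+ b)^* = ((w ^+ j) ^+ b)^-1.
    by rewrite invC_norm normrX w1 !expr1n invr1 mul1r.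
  rewrite exprD expfB_cond ?(negbTE (w0 j)) ?addn0 //=.
  by ring.
rewrite (bigD1 (Ordinal bkN)) //= sum_prim_root// eqxx big1 ?addr0.
  rewrite mulrC mulfK ?pnatr_eq0//.
  by rewrite natrD natrB// addrA addrAC addrK.
move=> m mne; rewrite sum_prim_root// modn_small// modn_small ?ltn_ord//.
rewrite ifN ?mulr0//; apply: contraNN mne => /eqP E; apply/eqP/val_inj => /=.
by rewrite E.
Qed.

(** The case of a constant trigonometric polynomial, whose derivative is 0. *)
Lemma riesz_weight_sum k (w : C) : (k.*2.+1).-primitive_root w ->
  \sum_(j < k.*2.+1) riesz_weight k w j = 0.
Proof.
move=> wN; have := riesz_weightE wN (leq0n k) (leq0n k).
by under eq_bigr do rewrite expr0 conjC1 !mulr1; rewrite subrr.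
Qed.

Lemma deriv_horner1 k (p : {poly C}) : (size p <= k.+1)%N ->
  p^`().[1] = \sum_(i < k.+1) p`_i * i%:R.
Proof.
move=> sp; rewrite big_ord_recl mulr0 add0r.
have sp' : (size p^`() <= k)%N.
  by apply: leq_trans (size_poly _ _) _; rewrite -ltnS; case: (size p) sp.
rewrite (horner_coef_wide _ sp'); apply: eq_bigr => i _.
by rewrite coef_deriv expr1n mulr1 mulr_natr.
Qed.

(** The right-hand side is the derivative of r(z) conj(p(z)) in the angle of z at
    z = 1, up to the factor 'i. *)
Lemma riesz_deriv k (w : C) (r p : {poly C}) : (k.*2.+1).-primitive_root w ->
  (size r <= k.+1)%N -> (size p <= k.+1)%N ->
  \sum_(j < k.*2.+1) riesz_weight k w j * (r.[w ^+ j] * (p.[w ^+ j])^*)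
  = r^`().[1] * (p.[1])^* - r.[1] * (p^`().[1])^*.
Proof.
move=> wN sr sp.
transitivity (\sum_(a < k.+1) \sum_(b < k.+1) r`_a * (p`_b)^* *
   \sum_(j < k.*2.+1) riesz_weight k w j * ((w ^+ j) ^+ a * ((w ^+ j) ^+ b)^*)).
  transitivity (\sum_(j < k.*2.+1) \sum_(a < k.+1) \sum_(b < k.+1)
     riesz_weight k w j * (r`_a * (w ^+ j) ^+ a * (p`_b * (w ^+ j) ^+ b)^*)).
    apply: eq_bigr => j _; rewrite (horner_coef_wide _ sr) (horner_coef_wide _ sp).
    rewrite rmorph_sum /= big_distrlr /= mulr_sumr; apply: eq_bigr => a _.
    by rewrite mulr_sumr.
  rewrite exchange_big /=; apply: eq_bigr => a _.
  rewrite exchange_big /=; apply: eq_bigr => b _.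
  rewrite mulr_sumr; apply: eq_bigr => j _.
  by rewrite rmorphM /=; ring.
transitivity (\sum_(a < k.+1) \sum_(b < k.+1)
   (r`_a * a%:R * (p`_b)^* - r`_a * ((p`_b)^* * b%:R))).
  apply: eq_bigr => a _; apply: eq_bigr => b _.
  have [ak bk] : (a <= k)%N /\ (b <= k)%N by rewrite -!(ltnS _ k) !ltn_ord.
  by rewrite riesz_weightE//; ring.
rewrite (deriv_horner1 sr) (deriv_horner1 sp) (horner_coef_wide _ sr) (horner_coef_wide _ sp).
rewrite !rmorph_sum /= !mulr_suml -sumrB; apply: eq_bigr => a _.
rewrite expr1n mulr1 !mulr_sumr -sumrB; apply: eq_bigr => b _.
by rewrite expr1n mulr1 rmorphM /= rmorph_nat.
Qed.

End riesz.

(** * Derivative of the powers of a matrix *)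

Section power_derivative.
Local Open Scope sesquilinear_scope.
Variable C : numClosedFieldType.

(** The derivative of the k-th power at U in the direction X U. *)
Definition power_diff n k (X U : 'M[C]_n) : 'M[C]_n :=
  \sum_(l < k) U ^+ l *m X *m U ^+ (k - l).

(** The matrix (1 + (z - 1)X)U with the indeterminate in place of z; for X a
    Hermitian projection and |z| = 1 it is a left translate of U by a unitary
    matrix. *)
Definition perturb n (X U : 'M[C]_n) : 'M[{poly C}]_n :=
  (1%:M + ('X - 1) *: map_mx polyC X) *m map_mx polyC U.

Lemma horner_perturb n (X U : 'M[C]_n) k z :
  map_mx (horner_eval z) (perturb X U ^+ k) = ((1%:M + (z - 1) *: X) *m U) ^+ k.
Proof.
rewrite rmorphXn /=; congr (_ ^+ _); rewrite /perturb map_mxM /=; congr (_ *m _).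
  rewrite map_mxD map_mx1 /= map_mxZ; congr (_ + _ *: _).
    by rewrite /= /horner_eval hornerD hornerN hornerX hornerC.
  by rewrite -map_mx_comp map_mx_id// => x /=; rewrite /horner_eval hornerC.
by rewrite -map_mx_comp map_mx_id// => x /=; rewrite /horner_eval hornerC.
Qed.

Lemma deriv_mulmx m n p (A : 'M[{poly C}]_(m, n)) (B : 'M[{poly C}]_(n, p)) :
  map_mx (@deriv C) (A *m B) = map_mx (@deriv C) A *m B + A *m map_mx (@deriv C) B.
Proof.
apply/matrixP => i j; rewrite !mxE raddf_sum -big_split /=.
by apply: eq_bigr => l _; rewrite derivM !mxE.
Qed.

Lemma deriv_perturb n (X U : 'M[C]_n) k :
  map_mx (horner_eval 1) (map_mx (@deriv C) (perturb X U ^+ k)) = power_diff k X U.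
Proof.
elim: k => [|k IH].
  rewrite /power_diff big_ord0 expr0; apply/matrixP => i j; rewrite !mxE.
  by rewrite /horner_eval /= -polyC_natr derivC hornerC.
rewrite exprS -[_ * _]/(_ *m _) deriv_mulmx map_mxD map_mxM [X in _ + X]map_mxM IH (horner_perturb X U k 1).
rewrite subrr scale0r addr0 mul1mx /=.
have -> : map_mx (horner_eval 1) (perturb X U) = U.
  by have := horner_perturb X U 1 1; rewrite !expr1 subrr scale0r addr0 mul1mx.
have -> : map_mx (horner_eval 1) (map_mx (@deriv C) (perturb X U)) = X *m U.
  rewrite /perturb deriv_mulmx.
  have dC (Y : 'M[C]_n) : map_mx (@deriv C) (map_mx polyC Y) = 0.
    by apply/matrixP => i j; rewrite !mxE derivC.
  rewrite dC mulmx0 addr0 map_mxM; congr (_ *m _); apply/matrixP => i j; rewrite !mxE.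
    rewrite /= -polyC_natr derivD derivC add0r derivM -polyC1 derivB derivX !derivC.
    by rewrite subr0 mul1r mulr0 addr0 /horner_eval hornerC.
  by rewrite /= /horner_eval hornerC.
rewrite /power_diff big_ord_recl expr0 mul1mx subn0 -mulmxA -[U *m _]/(U * _) -exprS.
congr (_ + _); rewrite mulmx_sumr; apply: eq_bigr => l _.
by rewrite !mulmxA exprS.
Qed.

Lemma size_perturb n (X U : 'M[C]_n) k i j : (size ((perturb X U ^+ k) i j) <= k.+1)%N.
Proof.
elim: k i j => [|k IH] i j.
  by rewrite expr0 mxE -polyC_natr (leq_trans (size_polyC_leq1 _)).
rewrite exprS mxE; apply: (leq_trans (size_sum _ _ _)); apply/bigmax_leqP => l _.
apply: (leq_trans (size_polyMleq _ _)).
suff s2 : (size (perturb X U i l) <= 2)%N.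
  by rewrite -subn1 leq_subLR add1n; apply: leq_trans (leq_add s2 (IH l j)) _.
rewrite mxE; apply: (leq_trans (size_sum _ _ _)); apply/bigmax_leqP => h _.
rewrite [X in _ * X]mxE; apply: (leq_trans (size_polyMleq _ _)).
suff s2 : (size ((1%:M + ('X - 1) *: map_mx polyC X : 'M[{poly C}]_n)%R i h) <= 2)%N.
  by rewrite -subn1 leq_subLR addnC leq_add// size_polyC_leq1.
rewrite !mxE -polyC_natr; apply: leq_trans (size_polyD _ _) _.
rewrite geq_max (leq_trans (size_polyC_leq1 _))//=.
apply: (leq_trans (size_polyMleq _ _)).
by rewrite -subn1 leq_subLR addnC leq_add// ?size_polyC_leq1// -polyC1 size_XsubC.
Qed.

Definition trace_poly n (Y X U : 'M[C]_n) k : {poly C} :=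
  \tr (map_mx polyC Y *m perturb X U ^+ k).

Lemma size_trace_poly n (Y X U : 'M[C]_n) k : (size (trace_poly Y X U k) <= k.+1)%N.
Proof.
apply: (leq_trans (size_sum _ _ _)); apply/bigmax_leqP => i _; rewrite mxE.
apply: (leq_trans (size_sum _ _ _)); apply/bigmax_leqP => h _; rewrite mxE mul_polyC.
by apply: leq_trans (size_scale_leq _ _) _; exact: size_perturb.
Qed.

Lemma horner_trace_poly n (Y X U : 'M[C]_n) k z :
  (trace_poly Y X U k).[z] = \tr (Y *m ((1%:M + (z - 1) *: X) *m U) ^+ k).
Proof.
rewrite -[LHS]/(horner_eval z (\tr _)) -trace_map_mx map_mxM horner_perturb.
by rewrite -map_mx_comp map_mx_id// => x /=; rewrite /horner_eval hornerC.
Qed.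

Lemma deriv_trace_poly n (Y X U : 'M[C]_n) k :
  (trace_poly Y X U k)^`().[1] = \tr (Y *m power_diff k X U).
Proof.
rewrite /trace_poly -deriv_perturb /mxtrace raddf_sum horner_sum.
apply: eq_bigr => i _; rewrite !mxE /= raddf_sum horner_sum; apply: eq_bigr => j _.
by rewrite !mxE /= deriv_mulC hornerCM.
Qed.

Lemma mxtrace_power_diff n k (X U : 'M[C]_n) :
  \tr (power_diff k X U) = k%:R * \tr (X *m U ^+ k).
Proof.
rewrite /power_diff raddf_sum /= (eq_bigr (fun=> \tr (X *m U ^+ k))).
  by rewrite sumr_const card_ord mulr_natl.
move=> l _; rewrite -mulmxA mxtrace_mulC -mulmxA -[_ ^+ (k - l) *m _]/(_ * _) -exprD.
by rewrite subnK// ltnW.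
Qed.

Lemma riesz_trace n k (w : C) (P U Y : 'M[C]_n) : (k.*2.+1).-primitive_root w ->
  \sum_(j < k.*2.+1) riesz_weight k w j *
    (\tr (Y *m ((1%:M + (w ^+ j - 1) *: P) *m U) ^+ k)
     * (\tr (((1%:M + (w ^+ j - 1) *: P) *m U) ^+ k))^*)
  = \tr (Y *m power_diff k P U) * (\tr (U ^+ k))^*
    - k%:R * (\tr (Y *m U ^+ k) * (\tr (P *m U ^+ k))^*).
Proof.
move=> wN.
have := riesz_deriv wN (size_trace_poly Y P U k) (size_trace_poly 1%:M P U k).
rewrite !deriv_trace_poly !mul1mx mxtrace_power_diff.
rewrite !horner_trace_poly !mul1mx subrr scale0r addr0 mul1mx => E.
rewrite [k%:R * _]mulrCA.
rewrite rmorphM /= rmorph_nat in E; rewrite -E; apply: eq_bigr => j _.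
by rewrite !horner_trace_poly mul1mx.
Qed.

Lemma mxtrace_delta n (M : 'M[C]_n) i j : \tr (delta_mx i j *m M) = M j i.
Proof.
rewrite /mxtrace (bigD1 i)//= big1 ?addr0.
  rewrite mxE (bigD1 j)//= big1 ?addr0 ?mxE ?eqxx ?mul1r//.
  by move=> h hj; rewrite mxE (negbTE hj) andbF mul0r.
by move=> h hi; rewrite mxE big1// => l _; rewrite mxE (negbTE hi) mul0r.
Qed.

Lemma sum_delta_mx_trace n (A B : 'M[C]_n) :
  \sum_(a < n) \sum_(b < n) \tr (delta_mx b a *m A) * \tr (delta_mx a b *m B) = \tr (A *m B).
Proof.
under eq_bigr do under eq_bigr do rewrite !mxtrace_delta.
by apply: eq_bigr => a _; rewrite mxE.
Qed.

(** Summing over matrix units contracts two traces, which turns a derivative of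
    tr U^k into products of traces of lower powers. *)
Lemma sum_delta_mx_sandwich n (A B : 'M[C]_n) :
  \sum_(a < n) \sum_(b < n) \tr (delta_mx b a *m (A *m delta_mx a b *m B)) = \tr A * \tr B.
Proof.
rewrite /mxtrace mulr_suml; apply: eq_bigr => a _; rewrite mulr_sumr; apply: eq_bigr => b _.
rewrite -[LHS]/(\tr _) mxtrace_delta mxE (bigD1 b)//= big1 ?addr0.
  rewrite mxE (bigD1 a)//= big1 ?addr0 ?mxE ?eqxx ?mulr1//.
  by move=> h ha; rewrite mxE (negbTE ha) mulr0.
move=> h hb; rewrite mxE big1 ?mul0r// => l _.
by rewrite mxE (negbTE hb) andbF mulr0.
Qed.

End power_derivative.

(** * Unitary matrices and Hermitian projections *)

Section unitary_algebra.
Local Open Scope sesquilinear_scope.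
Variable C : numClosedFieldType.

Definition herm_proj n (P : 'M[C]_n) := P^t* = P /\ P *m P = P.

Lemma adjmxM m n p (A : 'M[C]_(m, n)) (B : 'M[C]_(n, p)) : (A *m B)^t* = B^t* *m A^t*.
Proof. by rewrite trmx_mul map_mxM. Qed.

Lemma adjmxD m n (A B : 'M[C]_(m, n)) : (A + B)^t* = A^t* + B^t*.
Proof. by rewrite raddfD map_mxD. Qed.

Lemma adjmxZ m n a (A : 'M[C]_(m, n)) : (a *: A)^t* = a^* *: A^t*.
Proof. by apply/matrixP => i j; rewrite !mxE rmorphM. Qed.

Lemma mxtrace_adj n (A : 'M[C]_n) : \tr (A^t*) = (\tr A)^*.
Proof. by rewrite trace_map_mx mxtrace_tr. Qed.

Lemma adjmx1 n : (1%:M : 'M[C]_n)^t* = 1%:M.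
Proof. by rewrite trmx1 map_mx1. Qed.

Lemma unitary_exp n (U : 'M[C]_n) k : U \is unitarymx -> U ^+ k \is unitarymx.
Proof.
move=> Uu; elim: k => [|k IH]; last by rewrite exprS mul_unitarymx.
by rewrite expr0; apply/unitarymxP; rewrite adjmx1 mulmx1.
Qed.

Lemma unitary_phase n (P : 'M[C]_n) z : herm_proj P -> `|z| = 1 ->
  1%:M + (z - 1) *: P \is unitarymx.
Proof.
move=> [Ph PP] z1; apply/unitarymxP.
rewrite adjmxD adjmx1 adjmxZ Ph mulmxDl mul1mx mulmxDr mulmx1 -scalemxAl -scalemxAr PP.
rewrite -addrA -[RHS]addr0 scalerA; congr (_ + _).
rewrite -!scalerDl.
have -> : (z - 1)^* + (z - 1 + (z - 1) * (z - 1)^*) = z * z^* - 1.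
  by rewrite rmorphB rmorph1 /=; ring.
by rewrite -normCK z1 expr1n subrr scale0r.
Qed.

Lemma herm_proj_vector n (v : 'rV[C]_n) c : v *m v^t* = c%:M -> c != 0 -> c^* = c ->
  herm_proj (c^-1 *: (v^t* *m v)).
Proof.
move=> vv c0 cR; split.
  by rewrite adjmxZ adjmxM trmxCK fmorphV /= cR.
rewrite -scalemxAl -scalemxAr mulmxA -(mulmxA _ v) vv.
by rewrite -scalemx1 -!scalemxAr mulmx1 -scalemxAl scalerA mulVf// scale1r.
Qed.

Lemma delta_mx_herm_proj n (a : 'I_n) : herm_proj (delta_mx a a : 'M[C]_n).
Proof.
split; last by rewrite mul_delta_mx.
by rewrite trmx_delta map_delta_mx.
Qed.

(** With v = e_a + conj('i^j) e_b, the projection onto the line of v has 'i^(-j) / 2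
    at (a, b), and the sums of 'i^j and of 'i^(2j) over j < 4 vanish. *)
Lemma delta_mx_polar n (a b : 'I_n) : a != b -> exists P : 'I_4 -> 'M[C]_n,
  (forall j, herm_proj (P j)) /\
  delta_mx a b = \sum_(j < 4) ('i ^+ j / 2) *: P j.
Proof.
move=> ab.
pose v (j : 'I_4) : 'rV[C]_n := delta_mx 0 a + ('i ^+ j)^* *: delta_mx 0 b.
have vadj j : (v j)^t* = delta_mx a 0 + 'i ^+ j *: delta_mx b 0.
  by rewrite adjmxD adjmxZ !trmx_delta !map_delta_mx conjCK.
exists (fun j => 2^-1 *: ((v j)^t* *m v j)); split=> [j|].
  apply: herm_proj_vector; rewrite ?pnatr_eq0 ?rmorph_nat//.
  rewrite vadj mulmxDl !mulmxDr -!scalemxAl -!scalemxAr.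
  rewrite !mul_delta_mx_cond !eqxx [b == a]eq_sym (negbTE ab) !mulr0n !mulr1n.
  rewrite !scaler0 addr0 add0r.
  rewrite scalerA -normCKC normrX normCi expr1n expr1n scale1r.
  by apply/matrixP => i k; rewrite !mxE !ord1 !eqxx /= -natrD.
have E j : (v j)^t* *m v j = delta_mx a a + delta_mx b b
     + ('i ^+ j)^* *: delta_mx a b + 'i ^+ j *: delta_mx b a.
  rewrite vadj mulmxDl !mulmxDr -!scalemxAl -!scalemxAr !mul_delta_mx.
  rewrite scalerA -normCK normrX normCi expr1n expr1n scale1r.
  by rewrite [X in _ + X = _]addrC addrACA addrA.
under eq_bigr => j _ do rewrite E.
rewrite !big_ord_recl big_ord0 /=.
rewrite !expr0 /bump /= !add1n !rmorphXn /= conjCi.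
have i2 : 'i ^+ 2 = -1 :> C by exact: sqrCi.
have i3 : 'i ^+ 3 = - 'i :> C by rewrite exprS i2 mulrN1.
rewrite sqrrN i2 i3.
rewrite !expr1 rmorph1.
have -> : (- 'i) ^+ 3 = 'i :> C by rewrite exprS sqrrN i2 mulrN1 opprK.
apply/matrixP => i j; rewrite !mxE.
have ii : 'i * 'i = -1 :> C by rewrite -expr2.
move: ((i == a) && (j == b))%:R ((i == b) && (j == a))%:R => x y.
move: ((i == a) && (j == a))%:R ((i == b) && (j == b))%:R => t s.
transitivity ((1 - 'i * 'i) / 2 * x + (1 + 'i * 'i) / 2 * y); last by field.
by rewrite ii; field.
Qed.

Lemma delta_mx_herm_proj_span n (a b : 'I_n) : exists (P : 'I_4 -> 'M[C]_n) (c : 'I_4 -> C),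
  (forall j, herm_proj (P j)) /\ delta_mx a b = \sum_j c j *: P j.
Proof.
(* On the diagonal a single projection suffices; the other coefficients are 0. *)
have [<-|ab] := eqVneq a b; last first.
  by have [P [hP E]] := delta_mx_polar ab; exists P, (fun j => 'i ^+ j / 2).
exists (fun=> delta_mx a a), (fun j => (j == ord0)%:R); split=> [_|].
  exact: delta_mx_herm_proj.
by rewrite !big_ord_recl big_ord0 /= scale1r !scale0r !addr0.
Qed.

(** For a Hermitian projection X this is, up to the factor 'i, the derivative of
    tr(Y V^k) conj(tr V^k) in the angle of z at z = 1 along V = (1 + (z - 1)X)U.  It
    is written with tr(X (U^k)^t* ) in place of conj(tr(X U^k)): the two agree for
    Hermitian X, and the former is complex-linear in X, as polarization requires. *)
Definition loop_term n k (Y X U : 'M[C]_n) : C :=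
  \tr (Y *m power_diff k X U) * (\tr (U ^+ k))^*
  - k%:R * (\tr (Y *m U ^+ k) * \tr (X *m (U ^+ k)^t*)).

Lemma power_diff_sum n k (I : finType) (c : I -> C) (X : I -> 'M[C]_n) U :
  power_diff k (\sum_i c i *: X i) U = \sum_i c i *: power_diff k (X i) U.
Proof.
rewrite /power_diff.
under [RHS]eq_bigr do rewrite scaler_sumr.
rewrite exchange_big /=; apply: eq_bigr => l _.
rewrite mulmx_sumr mulmx_suml; apply: eq_bigr => i _.
by rewrite -scalemxAr -scalemxAl.
Qed.

Lemma loop_term_sum n k (I : finType) (c : I -> C) (X : I -> 'M[C]_n) Y U :
  loop_term k Y (\sum_i c i *: X i) U = \sum_i c i * loop_term k Y (X i) U.
Proof.
rewrite /loop_term power_diff_sum mulmx_sumr mulmx_suml !raddf_sum /=.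
rewrite mulr_suml !mulr_sumr -sumrB; apply: eq_bigr => i _.
by rewrite -scalemxAl -scalemxAr !mxtraceZ; ring.
Qed.

Lemma loop_term_herm_proj n k (w : C) (P U Y : 'M[C]_n) :
  (k.*2.+1).-primitive_root w -> herm_proj P ->
  loop_term k Y P U = \sum_(j < k.*2.+1) riesz_weight k w j *
    (\tr (Y *m ((1%:M + (w ^+ j - 1) *: P) *m U) ^+ k)
     * (\tr (((1%:M + (w ^+ j - 1) *: P) *m U) ^+ k))^*).
Proof.
move=> wN [Ph _]; rewrite riesz_trace// /loop_term; congr (_ - _ * (_ * _)).
by rewrite -mxtrace_adj adjmxM Ph mxtrace_mulC.
Qed.

(** The second part contributes k tr(U^k (U^k)^t* ) = k n by unitarity. *)
Lemma sum_loop_term n k (U : 'M[C]_n) : U \is unitarymx ->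
  \sum_(a < n) \sum_(b < n) loop_term k (delta_mx b a) (delta_mx a b) U =
  \sum_(l < k) \tr (U ^+ l) * \tr (U ^+ (k - l)) * (\tr (U ^+ k))^* - (k * n)%:R.
Proof.
move=> Uu; rewrite /loop_term.
under eq_bigr do rewrite sumrB; rewrite sumrB; congr (_ - _).
  under eq_bigr do rewrite -mulr_suml; rewrite -!mulr_suml; congr (_ * _).
  rewrite /power_diff.
  under eq_bigr do under eq_bigr do rewrite mulmx_sumr raddf_sum.
  under eq_bigr do rewrite exchange_big.
  rewrite exchange_big /=; apply: eq_bigr => l _.
  exact: sum_delta_mx_sandwich.
under eq_bigr do rewrite -mulr_sumr; rewrite -mulr_sumr sum_delta_mx_trace.
by rewrite (unitarymxP (unitary_exp k Uu)) mxtrace1 natrM.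
Qed.

Lemma unitary_entry_le1 n (U : 'M[C]_n) i j : U \is unitarymx -> `|U i j| <= 1.
Proof.
move=> /unitarymxP/matrixP/(_ i i) E.
have {}E : \sum_l U i l * (U i l)^* = 1.
  transitivity ((1%:M : 'M[C]_n) i i); last by rewrite mxE eqxx.
  by rewrite -E mxE; apply: eq_bigr => l _; rewrite !mxE.
rewrite -(@expr_le1 _ 2)// -[X in _ <= X]E (bigD1 j)//= -normCK lerDl sumr_ge0// => l _.
by rewrite -normCK exprn_ge0.
Qed.

Lemma trace_unitary_le n (U : 'M[C]_n) : U \is unitarymx -> `|\tr U| <= n%:R.
Proof.
move=> Uu; apply: le_trans (ler_norm_sum _ _ _) _.
rewrite -[n in n%:R]card_ord -sumr_const; apply: ler_sum => i _.
exact: unitary_entry_le1.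
Qed.

Lemma prod_XsubC_perm (s t : seq C) :
  \prod_(x <- s) ('X - x%:P) = \prod_(x <- t) ('X - x%:P) -> perm_eq s t.
Proof.
elim: s t => [|x s IH] t.
  move=> /(congr1 (size \o val)) /=; rewrite !size_prod_XsubC /= => -[].
  by case: t.
move=> E; have xt : x \in t.
  by rewrite -root_prod_XsubC -E root_prod_XsubC mem_head.
have pt := perm_to_rem xt; rewrite perm_sym (perm_trans pt)// perm_cons perm_sym.
apply: IH; move: E; rewrite (perm_big _ pt) !big_cons; apply: mulfI.
by rewrite polyXsubC_eq0.
Qed.

Lemma char_poly_conj n (P D : 'M[C]_n) : P \in unitmx ->
  char_poly (invmx P *m D *m P) = char_poly D.
Proof.
move=> Pu; rewrite /char_poly.
have -> : char_poly_mx (invmx P *m D *m P) =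
    map_mx polyC (invmx P) *m char_poly_mx D *m map_mx polyC P.
  rewrite /char_poly_mx mulmxBr mulmxBl !map_mxM; congr (_ - _).
  by rewrite -mulmxA -scalar_mxC mulmxA -map_mxM mulVmx// map_mx1 mul1mx.
by rewrite !det_mulmx mulrAC -det_mulmx -map_mxM mulVmx// map_mx1 det1 mul1r.
Qed.

(** The spectral theorem gives U the eigenvalues d_j, and unique factorization of
    the characteristic polynomial identifies them with the z_j up to order. *)
Lemma trace_exp_eigen n (U : 'M[C]_n) (z : 'I_n -> C) k : U \is unitarymx ->
  char_poly U = \prod_(j < n) ('X - (z j)%:P) -> \tr (U ^+ k) = \sum_(j < n) z j ^+ k.
Proof.
move=> Uu Ez.
have Un : U \is normalmx.
  apply/normalmxP; rewrite (unitarymxP Uu).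
  by have := Uu; rewrite -trmxC_unitary => /unitarymxP; rewrite trmxCK => ->.
have := orthomx_spectralP Un.
set P := spectralmx U; set d := spectral_diag U => EU.
have Pu : P \in unitmx by exact: spectral_unit.
have EUk : U ^+ k = invmx P *m diag_mx d ^+ k *m P.
  elim: k => [|k IH]; first by rewrite !expr0 mulmx1 mulVmx.
  rewrite exprSr [X in _ * X = _]EU IH [in RHS]exprSr -!mulmxE !mulmxA.
  by rewrite mulmxK.
have Edk : diag_mx d ^+ k = diag_mx (\row_j d 0 j ^+ k).
  elim: k {EUk} => [|k IH].
    by rewrite expr0; apply/matrixP => i j; rewrite !mxE expr0.
  rewrite exprS IH -mulmxE mulmx_diag; congr diag_mx.
  by apply/rowP => j; rewrite !mxE exprS.
rewrite EUk -mulmxA mxtrace_mulC -mulmxA mulmxV// mulmx1 Edk mxtrace_diag.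
have E2 : char_poly U = \prod_(j < n) ('X - (d 0 j)%:P).
  rewrite EU char_poly_conj// char_poly_trig ?diag_mx_is_trig//.
  by apply: eq_bigr => j _; rewrite !mxE eqxx.
have := @prod_XsubC_perm [seq d 0 j | j <- index_enum 'I_n] [seq z j | j <- index_enum 'I_n].
rewrite !big_map -E2 => /(_ Ez) pe.
under eq_bigr do rewrite mxE.
rewrite -(big_map (fun j => d 0 j) xpredT (fun x => x ^+ k)).
rewrite -(big_map z xpredT (fun x => x ^+ k)).
exact: perm_big.
Qed.

End unitary_algebra.

(** * Borel measurability on the unitary group *)

Section unitary_topology.
Variable R : realType.

Lemma contraction_continuous (f : {additive R[i] -> R}) :
  (forall z : R[i], (`|f z|%:C)%C <= `|z|) -> continuous (f : R[i] -> R).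
Proof.
move=> f1 z; apply/(@cvgrPdist_lt _ R^o _ (nbhs z) (nbhs_filter z)) => e e0.
have nb : nbhs z (ball (z : R[i]^o) (e%:C)%C).
  by apply: (@nbhsx_ballx _ R[i]^o); rewrite ltcR.
apply: (@filterS R[i] (nbhs z) (nbhs_filter z) _ _ _ nb) => y; rewrite /ball /= => zy.
by rewrite -raddfB -ltcR; apply: le_lt_trans zy.
Qed.

Lemma Re_continuous : continuous (fun z : R[i] => Re z : R).
Proof. by apply: contraction_continuous => z; exact: normc_ge_Re. Qed.

Lemma normc_ge_Im (z : R[i]) : (`|Im z|%:C)%C <= `|z|.
Proof.
have -> : Im z = Re (- 'i%C * z).
  by case: z => a b /=; rewrite ?oppr0 ?mul0r ?mulN1r ?sub0r ?opprK.
apply: le_trans (normc_ge_Re _) _.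
by rewrite normrM normrN complexiE normCi mul1r.
Qed.

Lemma Im_continuous : continuous (fun z : R[i] => Im z : R).
Proof. by apply: contraction_continuous => z; exact: normc_ge_Im. Qed.

Lemma entry_continuous n (i j : 'I_n) :
  continuous (fun V : unitary R n => unitary_mx V i j : R[i]).
Proof.
move=> V; apply: (@continuous_comp _ _ _ (@unitary_mx R n) (fun M : 'M[R[i]]_n => M i j)).
  exact: initial_continuous.
exact: coord_continuous.
Qed.

(** The unitary group has the topology induced by the entries. *)
Lemma unitary_continuous n (T : topologicalType) (f : T -> unitary R n) :
  (forall i j, continuous (fun x => unitary_mx (f x) i j : R[i])) -> continuous f.
Proof.
move=> cf; apply: continuous_comp_initial => x A [P nP sPA].
apply: filterS sPA _.
have H : \forall y \near x, forall i j, P i j (unitary_mx (f y) i j).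
  apply: filter_forall => i; apply: filter_forall => j; exact: (cf i j x).
exact: H.
Qed.

Lemma unitary_mul_continuous n (V : unitary R n) : continuous (unitary_mul V).
Proof.
apply: unitary_continuous => i j.
have -> : (fun x => unitary_mx (unitary_mul V x) i j) =
   (fun x => \sum_l unitary_mx V i l * unitary_mx x l j).
  by apply/funext => y; rewrite /unitary_mul /unitary_mx [LHS]mxE.
elim: (index_enum _) => [|l r IH].
  under eq_fun do rewrite big_nil.
  exact: cst_continuous.
under eq_fun do rewrite big_cons.
move=> x; apply: (@cvgD _ R[i]^o _ (nbhs x) (nbhs_filter x)); last exact: IH.
exact: (@cvgMl_tmp R[i] _ (nbhs x) (nbhs_filter x) _ _ _ (@entry_continuous n l j x)).
Qed.

Lemma borel_continuous_measurable n (g : unitary R n -> R) : continuous g ->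
  measurable_fun setT (g : borel_unitary R n -> R).
Proof.
move=> /continuousP cg; apply: (measurability _ (measurable_realfun.RGenOpens.measurableE R)).
move=> _ [_ [a [b ->] <-]]; rewrite setTI; apply: sub_sigma_algebra.
exact/cg/interval_open.
Qed.

Lemma unitary_mul_measurable n (V : unitary R n) :
  @measurable_fun _ _ (borel_unitary R n) (borel_unitary R n) setT (unitary_mul V).
Proof.
apply: (@measurability _ _ (borel_unitary R n) (borel_unitary R n) setT _ (@open (unitary R n))) => //.
move=> _ [B oB <-]; rewrite setTI; apply: sub_sigma_algebra.
by have /continuousP := @unitary_mul_continuous n V; apply.
Qed.

End unitary_topology.

(** * Expectation of bounded complex random variables *)

Section expectation.
Context d (T : measurableType d) (R : realType) (mu : probability T R).

(** A class of functions closed under the ring operations and conjugation on which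
    the expectation is linear without further integrability conditions. *)
Definition bmeas (f : T -> R[i]) :=
  [/\ measurable_fun setT (fun x => Re (f x)), measurable_fun setT (fun x => Im (f x))
   & exists M : R, forall x, `|f x| <= (M%:C)%C].

Definition expectC (f : T -> R[i]) : R[i] :=
  (Rintegral mu setT (fun x => Re (f x)) +i* Rintegral mu setT (fun x => Im (f x)))%C.

Lemma bmeas_cst c : bmeas (fun=> c).
Proof.
split; try exact: measurable_cst.
by exists (Re `|c|) => _; rewrite RRe_real ?normr_real.
Qed.

Lemma bmeasD f g : bmeas f -> bmeas g -> bmeas (fun x => f x + g x).
Proof.
move=> [f1 f2 [M fM]] [g1 g2 [N gN]]; split.
- by under eq_fun do rewrite raddfD; exact: measurable_funD.
- by under eq_fun do rewrite raddfD; exact: measurable_funD.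
- by exists (M + N) => x; rewrite (le_trans (ler_normD _ _))// rmorphD lerD.
Qed.

Lemma bmeasM f g : bmeas f -> bmeas g -> bmeas (fun x => f x * g x).
Proof.
move=> [f1 f2 [M fM]] [g1 g2 [N gN]]; split.
- have -> : (fun x => Re (f x * g x)) =
    (fun x => Re (f x) * Re (g x) - Im (f x) * Im (g x)).
    by apply/funext => x; case: (f x) (g x) => a b [].
  by apply: measurable_funB; exact: measurable_funM.
- have -> : (fun x => Im (f x * g x)) =
    (fun x => Re (f x) * Im (g x) + Im (f x) * Re (g x)).
    by apply/funext => x; case: (f x) (g x) => a b [].
  by apply: measurable_funD; exact: measurable_funM.
- by exists (M * N) => x; rewrite normrM rmorphM ler_pM.
Qed.

Lemma bmeas_conj f : bmeas f -> bmeas (fun x => (f x)^*).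
Proof.
move=> [f1 f2 [M fM]]; split.
- have -> : (fun x => Re (f x)^*) = (fun x => Re (f x)) by apply/funext => x; case: (f x).
  by [].
- have -> : (fun x => Im (f x)^*) = (fun x => - Im (f x)) by apply/funext => x; case: (f x).
  exact: measurableT_comp.
- by exists M => x; rewrite norm_conjC.
Qed.

Lemma bmeasN f : bmeas f -> bmeas (fun x => - f x).
Proof.
by move=> bf; under eq_fun do rewrite -mulN1r; apply: bmeasM => //; exact: bmeas_cst.
Qed.

Lemma bmeasB f g : bmeas f -> bmeas g -> bmeas (fun x => f x - g x).
Proof. by move=> bf bg; apply: bmeasD => //; exact: bmeasN. Qed.

Lemma bmeas_sum I (r : seq I) (f : I -> T -> R[i]) : (forall i, bmeas (f i)) ->
  bmeas (fun x => \sum_(i <- r) f i x).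
Proof.
move=> bf; elim: r => [|i r IH].
  by under eq_fun do rewrite big_nil; exact: bmeas_cst.
by under eq_fun do rewrite big_cons; exact: bmeasD.
Qed.

Lemma integrable_bounded (f : T -> R) (M : R) : measurable_fun setT f ->
  (forall x, `|f x| <= M) -> mu.-integrable setT (EFin \o f).
Proof.
move=> mf fM; apply: measurable_bounded_integrable => //.
  by rewrite [X in (X < _)%E]probability_setT ltry.
exists M; split; first exact: num_real.
by move=> x Mx y _; apply: le_trans (fM y) _; exact: ltW.
Qed.

Lemma integrable_Re f : bmeas f -> mu.-integrable setT (EFin \o (fun x => Re (f x))).
Proof.
move=> [f1 _ [M fM]]; apply: (@integrable_bounded _ M) => // x.
by rewrite -lecR; apply: le_trans (fM x); exact: normc_ge_Re.
Qed.

Lemma integrable_Im f : bmeas f -> mu.-integrable setT (EFin \o (fun x => Im (f x))).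
Proof.
move=> [_ f1 [M fM]]; apply: (@integrable_bounded _ M) => // x.
by rewrite -lecR; apply: le_trans (fM x); exact: normc_ge_Im.
Qed.

Lemma expectCD f g : bmeas f -> bmeas g ->
  expectC (fun x => f x + g x) = expectC f + expectC g.
Proof.
move=> bf bg; rewrite /expectC; under eq_Rintegral do rewrite raddfD.
under [in X in (_ +i* X)%C]eq_Rintegral do rewrite raddfD.
by rewrite !RintegralD//; do ?[exact: integrable_Re|exact: integrable_Im].
Qed.

Lemma expectC_cst c : expectC (fun=> c) = c.
Proof. by rewrite /expectC !Rintegral_cst// ![X in fine X]probability_setT !mulr1; case: c. Qed.

Lemma expectCZ c f : bmeas f -> expectC (fun x => c * f x) = c * expectC f.
Proof.
move=> bf; rewrite /expectC.
have rf := integrable_Re bf; have jf := integrable_Im bf.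
have int a g : mu.-integrable setT (EFin \o g) ->
    mu.-integrable setT (EFin \o (fun x => a * g x)).
  by move=> ig; exact: (@integrableZl _ _ _ mu _ measurableT a (EFin \o g)).
case: c => a b.
have -> : (fun x => Re ((a +i* b)%C * f x)) = (fun x => a * Re (f x) - b * Im (f x)).
  by apply/funext => x; case: (f x).
have -> : (fun x => Im ((a +i* b)%C * f x)) = (fun x => a * Im (f x) + b * Re (f x)).
  by apply/funext => x; case: (f x).
by rewrite RintegralB ?RintegralD ?RintegralZl//; apply: int.
Qed.

Lemma expectC_sum I (r : seq I) (f : I -> T -> R[i]) : (forall i, bmeas (f i)) ->
  expectC (fun x => \sum_(i <- r) f i x) = \sum_(i <- r) expectC (f i).
Proof.
move=> bf; elim: r => [|i r IH].
  by under eq_fun do rewrite big_nil; rewrite expectC_cst big_nil.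
under eq_fun do rewrite big_cons.
by rewrite expectCD// ?IH ?big_cons//; exact: bmeas_sum.
Qed.

Lemma expectCB f g : bmeas f -> bmeas g ->
  expectC (fun x => f x - g x) = expectC f - expectC g.
Proof.
move=> bf bg; rewrite expectCD//; last exact: bmeasN.
by congr (_ + _); under eq_fun do rewrite -mulN1r; rewrite expectCZ// mulN1r.
Qed.

Lemma le_Re_expectC f g : bmeas f -> bmeas g -> (forall x, Re (f x) <= Re (g x)) ->
  Re (expectC f) <= Re (expectC g).
Proof. by move=> bf bg fg; apply: le_Rintegral => //; exact: integrable_Re. Qed.

Lemma bmeas_comp (h : T -> T) f : measurable_fun setT h -> bmeas f ->
  bmeas (fun x => f (h x)).
Proof.
move=> mh [f1 f2 [M fM]]; split; last by exists M => x; exact: fM.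
  exact: (measurableT_comp f1 mh).
exact: (measurableT_comp f2 mh).
Qed.

Lemma expectC_comp (h : T -> T) f : measurable_fun setT h ->
  (forall A, measurable A -> mu (h @^-1` A) = mu A) ->
  bmeas f -> expectC (fun x => f (h x)) = expectC f.
Proof.
move=> mh inv bf.
have key (g : T -> R) (M : R) : measurable_fun setT g -> (forall x, `|g x| <= M) ->
    Rintegral mu setT (fun x => g (h x)) = Rintegral mu setT g.
  move=> mg gM; rewrite /Rintegral; congr fine.
  transitivity (\int[pushforward mu h]_y (g y)%:E)%E.
    rewrite (integral_pushforward mh (f := fun y => (g y)%:E))//.
    - exact/measurable_EFinP.
    - apply: (@integrable_bounded (g \o h) M) => [|x]; last exact: gM.
      exact: measurableT_comp.
  by apply: eq_measure_integral => A mA _; exact: inv.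
case: bf => f1 f2 [M fM]; congr (_ +i* _)%C.
  apply: (key (fun x => Re (f x)) M) => // x.
  by rewrite -lecR; apply: le_trans (fM x); exact: normc_ge_Re.
apply: (key (fun x => Im (f x)) M) => // x.
by rewrite -lecR; apply: le_trans (fM x); exact: normc_ge_Im.
Qed.

End expectation.

(** * The loop equation *)

Section haar.
Local Open Scope sesquilinear_scope.
Context (R : realType) (n : nat) (mu : probability (borel_unitary R n) R).
Local Notation T := (borel_unitary R n).

(** The preimage under translation by V is the image under translation by V^-1. *)
Lemma haar_preimage (V : unitary R n) (A : set T) : is_haar mu -> measurable A ->
  mu (unitary_mul V @^-1` A) = mu A.
Proof.
move=> Hmu mA.
have adjP : (unitary_mx V)^t* \in [set A : 'M[R[i]]_n | A \is unitarymx].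
  by apply/mem_set => /=; rewrite trmxC_unitary; exact: unitary_mxP.
pose V' : unitary R n := exist (fun A => A \in _) _ adjP.
have V'V : unitary_mx V' *m unitary_mx V = 1%:M.
  have := adjP; rewrite inE /= => /unitarymxP; rewrite trmxCK; exact.
have VV' : unitary_mx V *m unitary_mx V' = 1%:M by exact: mulmx1C.
rewrite -(Hmu V' A mA); congr (mu _); apply/seteqP; split => [W AW|_ [W AW <-]].
  exists (unitary_mul V W) => //; apply: val_inj => /=.
  by rewrite -[LHS]/(unitary_mx V' *m (unitary_mx V *m unitary_mx W)) mulmxA V'V mul1mx.
rewrite /preimage /=; suff -> : unitary_mul V (unitary_mul V' W) = W by [].
apply: val_inj => /=.
by rewrite -[LHS]/(unitary_mx V *m (unitary_mx V' *m unitary_mx W)) mulmxA VV' mul1mx.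
Qed.

Lemma expectC_haar (V : unitary R n) (f : T -> R[i]) : is_haar mu -> bmeas f ->
  expectC mu (fun W => f (unitary_mul V W)) = expectC mu f.
Proof.
move=> Hmu bf; apply: (@expectC_comp _ T R mu (unitary_mul V)) => //.
  exact: unitary_mul_measurable.
by move=> A mA; exact: haar_preimage.
Qed.

Lemma expectC_haar_sum N (c : 'I_N -> R[i]) (V : 'I_N -> unitary R n) (f : T -> R[i]) :
  is_haar mu -> bmeas f ->
  expectC mu (fun W => \sum_j c j * f (unitary_mul (V j) W)) = (\sum_j c j) * expectC mu f.
Proof.
move=> Hmu bf.
have bV j : bmeas (fun W : T => f (unitary_mul (V j) W)).
  exact: (bmeas_comp (@unitary_mul_measurable R n (V j)) bf).
rewrite expectC_sum => [|j]; last by apply: bmeasM => //; exact: bmeas_cst.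
by rewrite mulr_suml; apply: eq_bigr => j _; rewrite expectCZ// expectC_haar.
Qed.

Lemma bmeas_exp k i j : bmeas (fun W : T => (unitary_mx W ^+ k) i j).
Proof.
elim: k i j => [|k IH] i j; first by under eq_fun do rewrite expr0; exact: bmeas_cst.
under eq_fun do rewrite exprS mxE; apply: bmeas_sum => l; apply: bmeasM => //; split.
- apply: borel_continuous_measurable => W.
  apply: (@continuous_comp _ _ _ (fun W : unitary R n => unitary_mx W i l)).
    exact: entry_continuous.
  exact: Re_continuous.
- apply: borel_continuous_measurable => W.
  apply: (@continuous_comp _ _ _ (fun W : unitary R n => unitary_mx W i l)).
    exact: entry_continuous.
  exact: Im_continuous.
- by exists 1 => W; apply: unitary_entry_le1; exact: unitary_mxP.
Qed.

Lemma bmeas_trace (Y : 'M[R[i]]_n) k : bmeas (fun W : T => \tr (Y *m unitary_mx W ^+ k)).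
Proof.
apply: bmeas_sum => i; under eq_fun do rewrite mxE; apply: bmeas_sum => j.
by apply: bmeasM; [exact: bmeas_cst|exact: bmeas_exp].
Qed.

Definition power_trace k (W : T) : R[i] := \tr (unitary_mx W ^+ k).

Lemma bmeas_power_trace k : bmeas (power_trace k).
Proof. by have := bmeas_trace 1%:M k; under eq_fun do rewrite mul1mx. Qed.

Lemma power_trace_le k W : `|power_trace k W| <= n%:R.
Proof. by apply: trace_unitary_le; apply: unitary_exp; exact: unitary_mxP. Qed.

Lemma bmeas_loop_term k Y X : bmeas (fun W : T => loop_term k Y X (unitary_mx W)).
Proof.
rewrite /loop_term; apply: bmeasB; apply: bmeasM; [|exact/bmeas_conj/bmeas_power_trace| |].
- apply: bmeas_sum => i; under eq_fun do rewrite mxE; apply: bmeas_sum => j.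
  apply: bmeasM; first exact: bmeas_cst.
  under eq_fun do rewrite summxE; apply: bmeas_sum => l.
  under eq_fun do rewrite mxE; apply: bmeas_sum => a.
  apply: bmeasM; last exact: bmeas_exp.
  under eq_fun do rewrite mxE; apply: bmeas_sum => b.
  by apply: bmeasM; [exact: bmeas_exp|exact: bmeas_cst].
- exact: bmeas_cst.
- apply: bmeasM; first exact: bmeas_trace.
  apply: bmeas_sum => i; under eq_fun do rewrite mxE; apply: bmeas_sum => j.
  apply: bmeasM; first exact: bmeas_cst.
  by under eq_fun do rewrite !mxE; apply: bmeas_conj; exact: bmeas_exp.
Qed.

(** Riesz' formula writes the derivative as a combination, with weights of sum 0, of
    translates that all have the same mean. *)
Lemma expectC_loop_term_proj k (w : R[i]) (P Y : 'M[R[i]]_n) : is_haar mu ->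
  (k.*2.+1).-primitive_root w -> herm_proj P ->
  expectC mu (fun W : T => loop_term k Y P (unitary_mx W)) = 0.
Proof.
move=> Hmu wN hP.
pose F (W : T) := \tr (Y *m unitary_mx W ^+ k) * (power_trace k W)^*.
have bF : bmeas F by apply: bmeasM; [exact: bmeas_trace|exact/bmeas_conj/bmeas_power_trace].
have VP (j : nat) : 1%:M + (w ^+ j - 1) *: P \in [set A : 'M[R[i]]_n | A \is unitarymx].
  apply/mem_set; apply: unitary_phase => //.
  by rewrite normrX (prim_root_norm wN) expr1n.
pose V j : unitary R n := exist (fun A => A \in _) _ (VP j).
rewrite -[RHS](mul0r (expectC mu F)) -(riesz_weight_sum wN).
rewrite -(expectC_haar_sum (fun j => riesz_weight k w j) (fun j => V j) Hmu bF).
by congr expectC; apply/funext => W; rewrite (loop_term_herm_proj _ _ wN).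
Qed.

(** The expectation of [sum_loop_term]: each of its summands has mean 0, since a
    matrix unit is a combination of Hermitian projections. *)
Lemma loop_equation k (w : R[i]) : is_haar mu -> (k.*2.+1).-primitive_root w ->
  \sum_(l < k) expectC mu (fun W => power_trace l W * power_trace (k - l) W * (power_trace k W)^*) = (k * n)%:R.
Proof.
move=> Hmu wN; apply/eqP; rewrite -subr_eq0; apply/eqP.
have b3 l : bmeas (fun W => power_trace l W * power_trace (k - l) W * (power_trace k W)^*).
  apply: bmeasM; last exact/bmeas_conj/bmeas_power_trace.
  by apply: bmeasM; exact: bmeas_power_trace.
rewrite -(@expectC_sum _ _ _ mu _ (index_enum _) _ (fun l : 'I_k => b3 l)).
rewrite -[X in _ - X](expectC_cst mu) -expectCB; last 2 first.
- exact: (@bmeas_sum _ _ _ _ _ _ (fun l : 'I_k => b3 l)).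
- exact: bmeas_cst.
transitivity (expectC mu (fun W => \sum_(a < n) \sum_(b < n)
    loop_term k (delta_mx b a) (delta_mx a b) (unitary_mx W))).
  congr expectC; apply/funext => W; rewrite sum_loop_term//; exact: unitary_mxP.
rewrite expectC_sum => [|a]; last by apply: bmeas_sum => b; exact: bmeas_loop_term.
rewrite big1// => a _; rewrite expectC_sum => [|b]; last exact: bmeas_loop_term.
rewrite big1// => b _.
have [P [c [hP ->]]] := delta_mx_herm_proj_span R[i] a b.
under eq_fun do rewrite loop_term_sum.
rewrite expectC_sum => [|j]; last first.
  by apply: bmeasM; [exact: bmeas_cst|exact: bmeas_loop_term].
rewrite big1// => j _; rewrite expectCZ; last exact: bmeas_loop_term.
by rewrite (expectC_loop_term_proj _ Hmu wN (hP j)) mulr0.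
Qed.

End haar.

(** * The unit circle *)

Section expi_theory.
Variable R : realType.

Lemma expiD (s t : R) : expi (s + t) = expi s * expi t.
Proof.
rewrite /expi cosD sinD; apply/eqP; rewrite eq_complex /=.
by rewrite eqxx /= addrC eqxx.
Qed.

Lemma expi0 : expi (0 : R) = 1.
Proof. by rewrite /expi cos0 sin0. Qed.

Lemma expi_exp (t : R) k : expi t ^+ k = expi (k%:R * t).
Proof.
elim: k => [|k IH]; first by rewrite expr0 mul0r expi0.
by rewrite exprS IH -expiD -natr1 mulrDl mul1r addrC.
Qed.

Lemma expi_conj (t : R) : (expi t)^* = expi (- t).
Proof. by rewrite /expi cosN sinN. Qed.

Lemma norm_expi (t : R) : `|expi t| = 1.
Proof. by rewrite normc_def /= cos2Dsin2 sqrtr1. Qed.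

Lemma expi2pi : expi (2 * pi : R) = 1.
Proof. by rewrite mulr_natl /expi cos2pi sin2pi. Qed.

Lemma expi_neq1 (t : R) : 0 < t < 2 * pi -> expi t != 1.
Proof.
move=> /andP[t0 t2]; rewrite /expi eq_complex /= negb_and.
have s0 : 0 < sin (t / 2).
  by apply: sin_gt0_pi; rewrite divr_gt0//= ltr_pdivrMr// mulrC.
have -> : cos t = 1 - 2 * sin (t / 2) ^+ 2.
  have := cos2Dsin2 (t / 2); have -> : cos t = cos (t / 2 + t / 2) by congr cos; lra.
  by rewrite cosD -!expr2; lra.
by rewrite lt_eqF// gtrDl oppr_lt0 mulr_gt0 ?exprn_gt0.
Qed.

Lemma expi_primitive_root N : (0 < N)%N ->
  N.-primitive_root (expi (2 * pi / N%:R : R)).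
Proof.
move=> N0; have N0r : 0 < N%:R :> R by rewrite ltr0n.
rewrite /primitive_root_of_unity N0 /=; apply/forallP => i; rewrite unity_rootE expi_exp.
apply/eqP; have [->|iN] := eqVneq i.+1 N.
  by apply/eqP; rewrite mulrC divfK ?gt_eqF// expi2pi.
apply/negbTE; apply: expi_neq1.
have lti : (i.+1 < N)%N by rewrite ltn_neqAle iN ltn_ord.
apply/andP; split; first by rewrite mulr_gt0 ?ltr0n// divr_gt0 ?mulr_gt0 ?pi_gt0.
rewrite mulrA ltr_pdivrMr// mulrC ltr_pM2l ?mulr_gt0 ?pi_gt0//.
by rewrite ltr_nat.
Qed.

End expi_theory.

(** * Second moments of the traces of powers *)

Section moments.
Context (R : realType) (n : nat) (mu : probability (borel_unitary R n) R).
Local Notation T := (borel_unitary R n).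

Definition power_moment k : R := Re (expectC mu (fun W : T => power_trace k W * (power_trace k W)^*)).

Lemma Re_mulJ (z : R[i]) : ((Re (z * z^*))%:C)%C = `|z| ^+ 2.
Proof. by rewrite normCK RRe_real// -normCK realX// normr_real. Qed.

Lemma ge0_Re_mulJ (z : R[i]) : 0 <= Re (z * z^*).
Proof. by rewrite -lecR Re_mulJ exprn_ge0. Qed.

(** Used with z = tr U^k, whose norm is at most n, to bound a cubic term of the loop
    equation by n times an average of second moments. *)
Lemma Re_triple (x y z : R[i]) : `|z| <= n%:R ->
  - Re (x * y * z^*) <= n%:R / 2 * (Re (x * x^*) + Re (y * y^*)).
Proof.
move=> zn; apply: (@le_trans _ _ `|Re (x * y * z^*)|); first by rewrite -normrN ler_norm.
rewrite -lecR; apply: le_trans (normc_ge_Re _) _.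
rewrite !rmorphM rmorphD /= !Re_mulJ fmorphV !rmorph_nat !normrM norm_conjC.
apply: (@le_trans _ _ (`|x| * `|y| * n%:R)).
  by apply: ler_wpM2l => //; rewrite mulr_ge0.
rewrite mulrC -mulrA; apply: ler_wpM2l; first exact: ler0n.
rewrite -subr_ge0.
have -> : 2^-1 * (`|x| ^+ 2 + `|y| ^+ 2) - `|x| * `|y| = 2^-1 * (`|x| - `|y|) ^+ 2.
  by field.
by rewrite mulr_ge0 ?invr_ge0// real_exprn_even_ge0// realB// normr_real.
Qed.

Lemma bmeas_moment k : bmeas (fun W : T => power_trace k W * (power_trace k W)^*).
Proof. by apply: bmeasM; [|apply: bmeas_conj]; exact: bmeas_power_trace. Qed.

Lemma Re_realM (a : R) (z : R[i]) : Re ((a%:C)%C * z) = a * Re z.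
Proof. by case: z => x y /=; rewrite mul0r subr0. Qed.

Lemma Re_natM m (z : R[i]) : Re (m%:R * z) = m%:R * Re z.
Proof. by rewrite !mulr_natl raddfMn. Qed.

(** The loop equation divided by n; its term l = 0 is isolated, and the others are
    bounded by [Re_triple]. *)
Lemma power_moment_rec k : is_haar mu -> (0 < n)%N ->
  power_moment k.+1 <= k.+1%:R + \sum_(l < k) (power_moment l.+1 + power_moment (k - l)) / 2.
Proof.
move=> Hmu n0; have n0r : 0 < n%:R :> R by rewrite ltr0n.
pose F l (W : T) : R[i] := power_trace l W * power_trace (k.+1 - l) W * (power_trace k.+1 W)^*.
have bF l : bmeas (F l).
  apply: bmeasM; last exact/bmeas_conj/bmeas_power_trace.
  by apply: bmeasM; exact: bmeas_power_trace.
have E : n%:R * power_moment k.+1 + \sum_(l < k) Re (expectC mu (F l.+1)) = k.+1%:R * n%:R.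
  have := loop_equation Hmu (@expi_primitive_root R (k.+1.*2.+1) isT).
  move=> /(congr1 (@complex.Re R)); rewrite big_ord_recl raddfD raddf_sum /=.
  have -> : Re ((k.+1 * n)%:R : R[i]) = k.+1%:R * n%:R.
    by rewrite -[_%:R]mulr1 Re_natM mulr1 natrM.
  move=> <-; congr (_ + _).
  rewrite -Re_natM -expectCZ; last exact: bmeas_moment.
  by congr (Re (expectC _ _)); apply/funext => W; rewrite /power_trace expr0 mxtrace1 subn0 mulrA.
rewrite -(ler_pM2l n0r) -(lerD2r (\sum_(l < k) Re (expectC mu (F l.+1)))) E.
rewrite mulrDr [n%:R * k.+1%:R]mulrC -addrA lerDl mulr_sumr -big_split /=.
apply: sumr_ge0 => l _; rewrite -lerBlDr sub0r.
pose G (W : T) := ((n%:R / 2)%:C)%C *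
  (power_trace l.+1 W * (power_trace l.+1 W)^* + power_trace (k - l) W * (power_trace (k - l) W)^*).
have bG : bmeas G.
  apply: bmeasM; first exact: bmeas_cst.
  by apply: bmeasD; exact: bmeas_moment.
have -> : n%:R * ((power_moment l.+1 + power_moment (k - l)) / 2) = Re (expectC mu G).
  rewrite expectCZ; last by apply: bmeasD; exact: bmeas_moment.
  rewrite expectCD; try exact: bmeas_moment.
  by rewrite Re_realM raddfD /power_moment /=; field.
have -> : - Re (expectC mu (F l.+1)) = Re (expectC mu (fun W => -1 * F l.+1 W)).
  by rewrite expectCZ// mulN1r raddfN.
apply: le_Re_expectC => //.
  by apply: bmeasM => //; exact: bmeas_cst.
move=> W; rewrite mulN1r raddfN /F /G subSS Re_realM raddfD /=.
exact: Re_triple (power_trace_le _ _).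
Qed.

Lemma sum_pow2 k : \sum_(l < k) (2 ^+ l.+1 - 1) = 2 ^+ k.+1 - 2 - k%:R :> R.
Proof.
elim: k => [|k IH]; first by rewrite big_ord0 expr1 subrr subr0.
by rewrite big_ord_recr /= IH -natr1 !exprS; ring.
Qed.

(** The recursion is solved exactly by 2^k - 1. *)
Lemma power_moment_le k : is_haar mu -> (0 < n)%N -> (0 < k)%N -> power_moment k <= 2 ^+ k.
Proof.
move=> Hmu n0 k0; apply: (@le_trans _ _ (2 ^+ k - 1)); last by rewrite lerBlDr lerDl.
elim/ltn_ind: k k0 => -[//|k] IH _.
apply: le_trans (power_moment_rec _ Hmu n0) _.
apply: (@le_trans _ _ (k.+1%:R + \sum_(l < k) ((2 ^+ l.+1 - 1) + (2 ^+ (k - l) - 1)) / 2)).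
  rewrite lerD2l; apply: ler_sum => l _; rewrite ler_pM2r ?invr_gt0//.
  rewrite lerD// IH// ?ltnS//; first by rewrite leq_subr.
  by rewrite subn_gt0.
rewrite -mulr_suml big_split /=.
have -> : \sum_(l < k) (2 ^+ (k - l) - 1) = \sum_(l < k) (2 ^+ l.+1 - 1) :> R.
  rewrite (reindex_inj rev_ord_inj); apply: eq_bigr => l _ /=.
  by rewrite subKn.
by rewrite sum_pow2 -natr1; lra.
Qed.

End moments.

(** * Trigonometric approximation on the circle *)

Section fejer.
Variable R : realType.

(** Both sides are the squared chord; 1 - cos (s - t) is the form in which distances
    on the circle are measured below. *)
Lemma sqr_dist_expi (s t : R) :
  (cos s - cos t) ^+ 2 + (sin s - sin t) ^+ 2 = 2 * (1 - cos (s - t)).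
Proof. by rewrite cosB; have := cos2Dsin2 s; have := cos2Dsin2 t; lra. Qed.

Lemma cos_eq1_expi (s t : R) : cos (s - t) = 1 -> expi s = expi t.
Proof.
move=> E; have := sqr_dist_expi s t; rewrite E subrr mulr0 => /eqP.
rewrite paddr_eq0 ?sqr_ge0// !sqrf_eq0 !subr_eq0 => /andP[/eqP cE /eqP sE].
by rewrite /expi cE sE.
Qed.

(** Away from the diagonal of the circle, a large multiple of 1 - cos (s - t)
    dominates the bounded left-hand side; near the diagonal, continuity does.
    Compactness makes one constant C enough.  The penalty 1 - cos is used because
    its mean against the Fejer kernel can be computed and is small. *)
Lemma circle_modulus (f : R -> R) (e : R) : continuous f ->
  (forall s t, expi s = expi t -> f s = f t) -> 0 < e ->
  exists2 C : R, 0 <= C & forall s t, 0 <= s <= 2 * pi -> 0 <= t <= 2 * pi ->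
    `|f s - f t| <= e + C * (1 - cos (s - t)).
Proof.
move=> cf fper e0.
pose K : set (R * R) := `[0, 2 * pi] `*` `[0, 2 * pi].
have /compact_near_coveringP ncK : compact K.
  by apply: compact_setX; exact: segment_compact.
have cg : continuous (fun x : R * R => f x.1 - f x.2).
  move=> x; apply: cvgB; apply: (@cvg_comp _ _ _ _ f) (cf _).
    exact: cvg_fst.
  exact: cvg_snd.
have cd : continuous (fun x : R * R => cos (x.1 - x.2)).
  move=> x; apply: (@cvg_comp _ _ _ (fun x : R * R => x.1 - x.2) (@cos R)); last exact: continuous_cos.
  by apply: cvgB; [exact: cvg_fst|exact: cvg_snd].
have H : \forall C \near +oo, K `<=` (fun x => `|f x.1 - f x.2| <= e + C * (1 - cos (x.1 - x.2))).
  apply: ncK => -[s t] _.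
  have [E|NE] := eqVneq (cos (s - t)) 1.
    exists ([set x | `|f x.1 - f x.2| < e], [set C | 0 <= C]) => /=.
      split; last by exists 0; split => // C /ltW.
      have fst0 : f s - f t = 0 by rewrite (fper s t) ?subrr//; exact: cos_eq1_expi.
      have /cvgrPdist_lt/(_ e e0) := cg (s, t); apply: filterS => x /=.
      by rewrite fst0 sub0r normrN.
    move=> [x C] [/= xe C0]; apply: le_trans (ltW xe) _; rewrite lerDl mulr_ge0// ?subr_ge0 ?cos_le1.
  pose dl := (1 - cos (s - t)) / 2.
  have dl0 : 0 < dl by rewrite divr_gt0// subr_gt0 lt_neqAle NE cos_le1.
  pose B := `|f s - f t| + 1.
  exists ([set x | `|f x.1 - f x.2| <= B /\ dl <= 1 - cos (x.1 - x.2)], [set C | B / dl <= C]) => /=.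
    split; last by exists (B / dl); split => [|C /ltW]; rewrite ?num_real.
    have /cvgrPdist_lt/(_ 1 ltr01) := cg (s, t) => c1.
    have /cvgrPdist_lt/(_ dl dl0) := cd (s, t) => c2.
    apply: filterS2 c1 c2 => x /= x1 x2; split.
      have := ler_dist_dist (f x.1 - f x.2) (f s - f t); rewrite distrC => x3.
      have := le_trans (ler_norm _) (le_trans x3 (ltW x1)); rewrite /B; lra.
    have := ler_norm (cos (x.1 - x.2) - cos (s - t)); rewrite distrC => x3.
    have := le_lt_trans x3 x2; rewrite /dl; lra.
  move=> [x C] [/= [xB xd] CB]; apply: le_trans xB _.
  have B0 : 0 <= B by rewrite /B addr_ge0.
  have : B <= C * dl by rewrite -ler_pdivrMr.
  have : C * dl <= C * (1 - cos (x.1 - x.2)).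
    by apply: ler_wpM2l => //; apply: le_trans CB; rewrite divr_ge0// ltW.
  lra.
have [C [CP C0]] : exists C : R, (K `<=` (fun x => `|f x.1 - f x.2| <= e + C * (1 - cos (x.1 - x.2)))) /\ 0 <= C.
  near (pinfty_nbhs R) => C; exists C; split; first by near: C.
  by near: C; exists 0; split => // C /ltW.
exists C => // s t hs ht.
by apply: (CP (s, t)); split; rewrite /= in_itv.
Unshelve. all: by end_near. Qed.

Definition dirichlet m (s : R) : R[i] := \sum_(a < m) expi s ^+ a.

Definition fejer m (s : R) : R :=
  m%:R^-1 * \sum_(a < m) \sum_(b < m) cos ((a%:R - b%:R) * s).

Lemma Re_expi_mulJ (s t : R) : Re (expi s * (expi t)^*) = cos (s - t).
Proof. by rewrite expi_conj -expiD. Qed.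

Lemma fejer_dirichlet m s : fejer m s = m%:R^-1 * Re (dirichlet m s * (dirichlet m s)^*).
Proof.
congr (_ * _); rewrite rmorph_sum big_distrlr raddf_sum; apply: eq_bigr => a _ /=.
rewrite raddf_sum; apply: eq_bigr => b _ /=.
by rewrite !expi_exp Re_expi_mulJ -mulrBl.
Qed.

Lemma fejer_ge0 m s : 0 <= fejer m s.
Proof. by rewrite fejer_dirichlet mulr_ge0 ?ge0_Re_mulJ// invr_ge0. Qed.

Lemma Re_mulJM (x y : R[i]) : Re (x * y * (x * y)^*) = Re (x * x^*) * Re (y * y^*).
Proof.
apply: complexI; rewrite [RHS]rmorphM Re_mulJ normrM exprMn.
by congr (_ * _); rewrite -Re_mulJ.
Qed.

Lemma Re_mulJ_expi_sub1 (s : R) : Re ((expi s - 1) * (expi s - 1)^*) = 2 * (1 - cos s).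
Proof.
have -> : (expi s - 1) = ((cos s - 1) +i* sin s)%C by rewrite /expi; simpc.
rewrite /=; have := cos2Dsin2 s; lra.
Qed.

(** Multiplication by |e^(is) - 1|^2 telescopes the Dirichlet sum to e^(ims) - 1,
    whose squared norm is at most 4. *)
Lemma fejer_concentration m s : fejer m s * (1 - cos s) <= 2 * m%:R^-1.
Proof.
rewrite fejer_dirichlet -mulrA mulrC.
have -> : Re (dirichlet m s * (dirichlet m s)^*) * (1 - cos s) = 1 - cos (m%:R * s).
  have := Re_mulJM (expi s - 1) (dirichlet m s).
  rewrite -subrX1 expi_exp !Re_mulJ_expi_sub1; lra.
apply: ler_wpM2r; rewrite ?invr_ge0//.
have := cos_geN1 (m%:R * s); lra.
Qed.

Definition node N (i : nat) : R := i%:R * (2 * pi / N%:R).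

(** On a grid of N >= m points, orthogonality of the characters of Z/N kills every
    off-diagonal term of the kernel. *)
Lemma mean_fejer m N t : (0 < m <= N)%N -> N%:R^-1 * \sum_(i < N) fejer m (t - node N i) = 1.
Proof.
move=> /andP[m0 mN]; have N0 : (0 < N)%N by exact: leq_trans mN.
have wN := @expi_primitive_root R N N0; set w := expi _ in wN.
have mr0 : m%:R != 0 :> R by rewrite pnatr_eq0 -lt0n.
have Nr0 : N%:R != 0 :> R by rewrite pnatr_eq0 -lt0n.
rewrite /fejer -mulr_sumr exchange_big /=.
transitivity (N%:R^-1 * (m%:R^-1 * \sum_(a < m) (N%:R : R))); last first.
  by rewrite sumr_const card_ord -[N%:R *+ m]mulr_natr; field; rewrite mr0 Nr0.
congr (_ * (_ * _)); apply: eq_bigr => a _.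
rewrite exchange_big (bigD1 a) //= [X in _ + X]big1 ?addr0.
  by under eq_bigr do rewrite subrr mul0r cos0; rewrite sumr_const card_ord.
move=> b ba.
transitivity (Re (expi t ^+ a * (expi t ^+ b)^* *
   \sum_(i < N) (w ^+ i) ^+ b * ((w ^+ i) ^+ a)^-1)).
  rewrite mulr_sumr raddf_sum; apply: eq_bigr => i _ /=.
  have -> : ((w ^+ i) ^+ a)^-1 = ((w ^+ i) ^+ a)^*.
    by rewrite invC_norm !normrX (prim_root_norm wN) !expr1n invr1 mul1r.
  rewrite /w !expi_exp !expi_conj -!expiD /=; congr cos.
  by rewrite /node; ring.
rewrite sum_prim_root// !modn_small ?(leq_trans (ltn_ord _))//.
by rewrite val_eqE (negbTE ba) mulr0.
Qed.

(** The approximant averages f over m grid points against the Fejer kernel.  This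
    average preserves constants and is positive, so [circle_modulus] reduces the
    error to the mean of 1 - cos, which is O(1/m) by [fejer_concentration]. *)
Lemma trig_approx (f : R -> R) (e : R) : continuous f ->
  (forall s t, expi s = expi t -> f s = f t) -> 0 < e ->
  exists (I : finType) (c : I -> R) (k : I -> nat) (u : I -> R),
  forall t, 0 <= t < 2 * pi -> `|f t - \sum_x c x * cos ((k x)%:R * t + u x)| <= e.
Proof.
move=> cf fper e0; have e2 : 0 < e / 2 by lra.
have [C C0 fC] := circle_modulus cf fper e2.
have [m m0 mC] : exists2 m : nat, (0 < m)%N & C * (2 * m%:R^-1) <= e / 2.
  (* The error C * 2/m has to be at most e/2. *)
  exists (Num.truncn (4 * C / e)).+1 => //.
  rewrite mulrA ler_pdivrMr ?ltr0n//.
  have := truncnS_gt (4 * C / e).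
  rewrite ltr_pdivrMr// => h; lra.
have mr0 : 0 < m%:R :> R by rewrite ltr0n.
pose q t := m%:R^-1 * \sum_(i < m) f (node m i) * fejer m (t - node m i).
(* The term (i, (a, b)) is cos ((a - b)(t - t_i)); as cos is even, the frequency is
   |a - b|, written (a - b) + (b - a) with truncated subtractions. *)
exists ('I_m * ('I_m * 'I_m))%type,
  (fun x : 'I_m * ('I_m * 'I_m) => m%:R^-1 * f (node m x.1) * m%:R^-1),
  (fun x : 'I_m * ('I_m * 'I_m) => (x.2.1 - x.2.2 + (x.2.2 - x.2.1))%N),
  (fun x : 'I_m * ('I_m * 'I_m) => - ((x.2.1 - x.2.2 + (x.2.2 - x.2.1))%N%:R * node m x.1)) => t ht.
have -> : \sum_(x : 'I_m * ('I_m * 'I_m)) m%:R^-1 * f (node m x.1) * m%:R^-1 *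
    cos ((x.2.1 - x.2.2 + (x.2.2 - x.2.1))%N%:R * t
         + - ((x.2.1 - x.2.2 + (x.2.2 - x.2.1))%N%:R * node m x.1)) = q t.
  rewrite /q mulr_sumr -(pair_bigA _ (fun (i : 'I_m) (y : 'I_m * 'I_m) =>
    m%:R^-1 * f (node m i) * m%:R^-1 *
    cos ((y.1 - y.2 + (y.2 - y.1))%N%:R * t + - ((y.1 - y.2 + (y.2 - y.1))%N%:R * node m i)))) /=.
  apply: eq_bigr => i _; rewrite -mulr_sumr /fejer !mulrA; congr (_ * _).
  rewrite pair_bigA /=; apply: eq_bigr => -[a b] _ /=; rewrite -mulrBr.
  have [ab|/ltnW ab] := leqP a b.
    have -> : (a - b = 0)%N by apply/eqP; rewrite subn_eq0.
    by rewrite add0n natrB// -cosN -mulNr opprB.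
  have -> : (b - a = 0)%N by apply/eqP; rewrite subn_eq0.
  by rewrite addn0 natrB.
have -> : f t - q t = m%:R^-1 * \sum_(i < m) (f t - f (node m i)) * fejer m (t - node m i).
  have {1}-> : f t = f t * (m%:R^-1 * \sum_(i < m) fejer m (t - node m i)).
    by rewrite mean_fejer ?m0 ?leqnn// mulr1.
  rewrite /q mulrCA -mulrBr mulr_sumr -sumrB; congr (_ * _); apply: eq_bigr => i _.
  by rewrite mulrBl.
rewrite normrM ger0_norm ?invr_ge0//.
apply: (@le_trans _ _ (m%:R^-1 * \sum_(i < m)
   (e / 2 * fejer m (t - node m i) + C * (2 * m%:R^-1)))).
  rewrite ler_pM2l ?invr_gt0//; apply: le_trans (ler_norm_sum _ _ _) _.
  apply: ler_sum => i _; rewrite normrM (ger0_norm (fejer_ge0 _ _)).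
  apply: (@le_trans _ _ ((e / 2 + C * (1 - cos (t - node m i))) * fejer m (t - node m i))).
    apply: ler_wpM2r; first exact: fejer_ge0.
    apply: fC; first by case/andP: ht => -> /ltW.
    rewrite /node mulr_ge0 ?divr_ge0 ?mulr_ge0 ?pi_ge0//=.
    rewrite mulrA ler_pdivrMr// mulrC ler_pM2l ?mulr_gt0 ?pi_gt0//.
    by rewrite ler_nat ltnW.
  rewrite mulrDl lerD2l -mulrA ler_wpM2l// mulrC; exact: fejer_concentration.
rewrite big_split /= -mulr_sumr mulrDr mulrCA mean_fejer ?m0 ?leqnn// mulr1.
have -> : m%:R^-1 * \sum_(i < m) C * (2 / m%:R) = C * (2 / m%:R).
  by rewrite sumr_const card_ord -[(C * _) *+ m]mulr_natl mulKf// gt_eqF.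
lra.
Qed.

End fejer.

(** * Integrals against the counting and uniform measures *)

Section integrals.
Variable R : realType.
Local Notation borelR := (measurableTypeR R).

Lemma expi_continuous : continuous (@expi R).
Proof.
move=> t A /(@nbhs_ballP _ R[i]^o) [e /= e0 eA].
have [r r0 er] : exists2 r : R, 0 < r & e = (r%:C)%C.
  by case: e e0 {eA} => r i; rewrite ltcE /= => /andP[/eqP -> r0]; exists r.
have cg : continuous (fun s : R => 2 * (1 - cos (t - s))).
  move=> s; apply: cvgMr; apply: cvgB; first exact: cvg_cst.
  apply: (@cvg_comp _ _ _ (fun s : R => t - s) (@cos R)); last exact: continuous_cos.
  by apply: cvgB; [exact: cvg_cst|exact: cvg_id].
have r2 : 0 < r ^+ 2 by rewrite exprn_gt0.
have /cvgrPdist_lt/(_ _ r2) := cg t; apply: filterS => s /=.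
rewrite subrr cos0 subrr mulr0 sub0r normrN -sqr_dist_expi => h; apply: eA.
rewrite /ball /= er normc_def ltcR /=.
have Er : r = Num.sqrt (r ^+ 2) by rewrite sqrtr_sqr gtr0_norm.
by rewrite [X in _ < X]Er ltr_sqrt//; apply: le_lt_trans h; rewrite ler_norm.
Qed.

(** The counting measure is a scaled finite sum of Dirac masses. *)
Lemma ge0_integral_counting n (theta : 'I_n -> R) (D : set borelR) (f : borelR -> \bar R) :
  measurable D -> measurable_fun D f -> (forall t, D t -> (0 <= f t)%E) ->
  (forall j, D (theta j)) ->
  (\int[counting_measure theta]_(t in D) f t = (n%:R^-1)%:E * \sum_(j < n) f (theta j))%E.
Proof.
move=> mD mf f0 tD.
have n0 : 0 <= n%:R^-1 :> R by rewrite invr_ge0.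
pose delta (k : nat) : {measure set borelR -> \bar R} :=
  if insub k is Some j then dirac (theta j : borelR) else mzero.
transitivity (\int[mscale (NngNum n0) (msum delta n)]_(t in D) f t)%E.
  apply: eq_measure_integral => A mA AD.
  rewrite /= /counting_measure /mscale /msum /= EFinM; congr (_ * _)%E.
  rewrite -sum1_card natr_sum -sumEFin big_mkcond/=; apply: eq_bigr => j _.
  by rewrite /delta valK /= inE diracE; case: (theta j \in A).
rewrite ge0_integral_mscale//; congr (_ * _)%E.
rewrite ge0_integral_measure_sum//; apply: eq_bigr => j _.
rewrite /delta valK integral_dirac// diracE mem_set ?mul1e//.
Qed.

Lemma Rintegral_counting n (theta : 'I_n -> R) (D : set borelR) (f : borelR -> R) :
  measurable D -> measurable_fun D f -> (forall j, D (theta j)) ->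
  \int[counting_measure theta]_(t in D) f t = n%:R^-1 * \sum_(j < n) f (theta j).
Proof.
move=> mD mf tD; have mE : measurable_fun D (EFin \o f) by exact/measurable_EFinP.
rewrite /Rintegral integralE !ge0_integral_counting//.
- have -> : \sum_(j < n) (EFin \o f)^\+%E (theta j) = (\sum_(j < n) Num.max (f (theta j)) 0)%:E.
    by rewrite -sumEFin; apply: eq_bigr => j _; rewrite funeposE EFin_max.
  have -> : \sum_(j < n) (EFin \o f)^\-%E (theta j) = (\sum_(j < n) Num.max (- f (theta j)) 0)%:E.
    by rewrite -sumEFin; apply: eq_bigr => j _; rewrite funenegE EFin_max.
  rewrite -!EFinM -EFinB /= -mulrBr -sumrB; congr (_ * _); apply: eq_bigr => j _.
  by rewrite /Num.max; case: ltP => ?; case: ltP => ?; lra.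
- exact: measurable_funeneg.
- exact: measurable_funepos.
Qed.

Lemma Rintegral_mscale d (T : measurableType d) (m : {measure set T -> \bar R})
    (k : {nonneg R}) (D : set T) (f : T -> R) :
  measurable D -> m.-integrable D (EFin \o f) ->
  Rintegral (mscale k m) D f = k%:num * Rintegral m D f.
Proof.
move=> mD fi; have mf := measurable_int _ fi.
rewrite /Rintegral integralE !ge0_integral_mscale//; last 2 first.
- exact: measurable_funeneg.
- exact: measurable_funepos.
have ip := integrable_pos_fin_num mD fi; have iN := integrable_neg_fin_num mD fi.
rewrite -muleBr//; last by rewrite fin_num_adde_defr// fin_numN.
rewrite fineM//; last by rewrite fin_numB ip iN.
by rewrite [in RHS]integralE.
Qed.

Lemma cos_affine_continuous (k u : R) : continuous (fun t : R => cos (k * t + u)).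
Proof.
move=> t; apply: (@cvg_comp _ _ _ (fun s : R => k * s + u) (@cos R)); last exact: continuous_cos.
by apply: cvgD; [apply: cvgMr; exact: cvg_id|exact: cvg_cst].
Qed.

Lemma continuous_integrable_circle (f : R -> R) : continuous f ->
  lebesgue_measure.-integrable `[0, 2 * pi : R] (EFin \o f).
Proof.
move=> cf; apply: continuous_compact_integrable; first exact: segment_compact.
exact: continuous_subspaceT.
Qed.

Lemma continuous_integrable_angles (f : R -> R) : continuous f ->
  lebesgue_measure.-integrable `[0, 2 * pi : R[ (EFin \o f).
Proof.
move=> /continuous_integrable_circle cf.
by apply: integrableS cf => //; exact: subset_itv_co_cc.
Qed.

Lemma Rintegral_uniform (f : R -> R) : continuous f ->
  \int[uniform_circle]_(t in angles) f t =
  (2 * pi)^-1 * \int[lebesgue_measure]_(t in `[0, 2 * pi]) f t.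
Proof.
move=> cf.
have i2 := continuous_integrable_angles cf.
have mA : measurable (@angles R) by exact: measurable_angles.
have E (g : R -> \bar R) : (\int[mrestr lebesgue_measure (@measurable_angles R)]_(t in angles) g t
   = \int[lebesgue_measure]_(t in angles) g t)%E.
  by apply: eq_measure_integral => A mA' AD; rewrite /= /mrestr (setIidl AD).
rewrite [LHS]Rintegral_mscale//.
  rewrite /Rintegral E; congr (_ * _).
  exact: Rintegral_itv_bndo_bndc.
apply/integrableP; split; first by have /integrableP[] := i2.
by rewrite E; have /integrableP[] := i2.
Qed.

Lemma dist_Rintegral_uniform (f g : R -> R) (e : R) : continuous f -> continuous g ->
  (forall t, 0 <= t < 2 * pi -> `|f t - g t| <= e) ->
  `|\int[uniform_circle]_(t in angles) f t - \int[uniform_circle]_(t in angles) g t| <= e.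
Proof.
move=> cf cg fg; rewrite !Rintegral_uniform// -mulrBr.
have ic := continuous_integrable_angles.
have p0 : 0 < 2 * pi :> R by rewrite mulr_gt0 ?pi_gt0.
rewrite -!Rintegral_itv_bndo_bndc; [|exact: ic..].
rewrite -RintegralB//; [|exact: ic..].
have ifg : lebesgue_measure.-integrable `[0, 2 * pi : R[ (EFin \o (fun t => f t - g t)).
  by apply: ic => t; apply: cvgB; [exact: cf|exact: cg].
rewrite normrM ger0_norm ?invr_ge0 ?(ltW p0)//.
rewrite mulrC ler_pdivrMr//.
apply: le_trans (le_normr_Rintegral _ ifg) _ => //.
apply: (@le_trans _ _ (\int[lebesgue_measure]_(t in `[0, 2 * pi[) (cst e t))).
  apply: le_Rintegral => //.
  - by have := integrable_norm ifg.
  - by apply: ic; exact: cst_continuous.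
by rewrite Rintegral_cst// [X in fine X]lebesgue_measure_itv /= lte_fin p0 /= subr0.
Qed.

Lemma Rintegral_cos k (u : R) :
  \int[lebesgue_measure]_(t in `[0, 2 * pi]) cos (k%:R * t + u) =
  if k == 0%N then 2 * pi * cos u else 0.
Proof.
have p0 : 0 < 2 * pi :> R by rewrite mulr_gt0 ?pi_gt0.
case: eqVneq => [->|k0].
  under eq_Rintegral do rewrite mul0r add0r.
  by rewrite Rintegral_cst// [X in fine X]lebesgue_measure_itv /= lte_fin p0 /= subr0 mulrC.
have kr0 : k%:R != 0 :> R by rewrite pnatr_eq0.
pose F (t : R) := k%:R^-1 * sin (k%:R * t + u).
have dF (t : R) : is_derive t 1 F (cos (k%:R * t + u)).
  apply: is_derive_eq.
  by rewrite addr0 -[_%:A]/(_ * 1) mulr1 -[LHS]/(_ * _) mulrCA mulVf// mulr1.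
have cc := @cos_affine_continuous k%:R u.
have cF : continuous F by move=> t; apply: differentiable_continuous; apply/derivable1_diffP; have [] := dF t.
rewrite /Rintegral (@continuous_FTC2 _ _ F)//; last 3 first.
- exact: continuous_subspaceT.
- split; [by move=> t _; have [] := dF t| |].
  + exact/cvg_at_right_filter/cF.
  + exact/cvg_at_left_filter/cF.
- by move=> t _; rewrite derive1E; have [_ ->] := dF t.
rewrite /= /F mulr0 add0r.
have -> : sin (k%:R * (2 * pi) + u) = sin u.
  rewrite sinD.
  have := expi_exp (2 * pi : R) k; rewrite expi2pi expr1n => -[<- <-].
  by rewrite mul0r add0r mul1r.
by rewrite subrr.
Qed.

End integrals.

(** * Deviation of a trigonometric linear statistic *)

Section markov.
Context d (T : measurableType d) (R : realType) (mu : probability T R).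

Lemma expectC_markov (G : T -> R[i]) (a : R) : bmeas G -> (forall x, 0 <= Re (G x)) ->
  0 < a -> (mu [set x | a <= Re (G x)]%R <= (a^-1 * Re (expectC mu G))%:E)%E.
Proof.
move=> bG G0 a0; case: (bG) => mG _ _.
have mE : measurable_fun setT (fun x => (Re (G x))%:E) by exact/measurable_EFinP.
have := @le_integral_comp_abse _ T R mu setT measurableT (fun x => (Re (G x))%:E) a id
  (@measurable_id _ _ _) (fun r h => h) (fun x y _ _ h => h) mE a0.
rewrite setTI.
have -> : [set x | (a%:E <= `|(Re (G x))%:E|)%E] = [set x | a <= Re (G x)].
  by apply/seteqP; split => x /=; rewrite lee_fin ger0_norm.
have -> : (\int[mu]_x `|(Re (G x))%:E| = (Re (expectC mu G))%:E)%E.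
  rewrite /expectC /= /Rintegral fineK.
    by apply: eq_integral => x _; rewrite /= ger0_norm.
  by have := integrable_fin_num measurableT (integrable_Re mu bG).
by move=> h; rewrite mulrC EFinM lee_pdivlMr// muleC.
Qed.

End markov.

Lemma measurable_ge_set d (T : measurableType d) (R : realType) (g : T -> R) (a : R) :
  measurable_fun setT g -> measurable [set x | a <= g x].
Proof.
move=> mg; rewrite -[X in measurable X]setTI.
have -> : [set x | a <= g x] = g @^-1` `[a, +oo[.
  by apply/seteqP; split => x /=; rewrite in_itv /= andbT.
exact: mg.
Qed.

Lemma measurable_gt_set d (T : measurableType d) (R : realType) (g : T -> R) (a : R) :
  measurable_fun setT g -> measurable [set x | a < g x].
Proof.
move=> mg; rewrite -[X in measurable X]setTI.
have -> : [set x | a < g x] = g @^-1` `]a, +oo[.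
  by apply/seteqP; split => x /=; rewrite in_itv /= andbT.
exact: mg.
Qed.

Section deviation.
Variable R : realType.

Lemma sqr_sum_le (I : finType) (a : I -> R) :
  (\sum_x a x) ^+ 2 <= #|I|%:R * \sum_x a x ^+ 2.
Proof.
rewrite expr2 big_distrlr /=.
apply: (@le_trans _ _ (\sum_x \sum_y (a x ^+ 2 + a y ^+ 2) / 2)).
  apply: ler_sum => x _; apply: ler_sum => y _.
  by rewrite ler_pdivlMr//; have := sqr_ge0 (a x - a y); lra.
rewrite (eq_bigr (fun x => (#|I|%:R * a x ^+ 2 + \sum_y a y ^+ 2) / 2)); last first.
  by move=> x _; rewrite -mulr_suml big_split /= sumr_const -[_ *+ #|_|]mulr_natl.
rewrite -mulr_suml big_split /= sumr_const -mulr_sumr -[_ *+ #|_|]mulr_natl.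
by lra.
Qed.

Section fixed_n.
Context (n : nat) (mu : probability (borel_unitary R n) R).
Local Notation T := (borel_unitary R n).

(** The integral of t |-> cos (k t + u) against the counting measure, as a function
    of the matrix; see [cos_stat_eigen]. *)
Definition cos_stat k (u : R) (W : T) : R := n%:R^-1 * Re (expi u * power_trace k W).

Lemma measurable_cos_stat k u : measurable_fun setT (cos_stat k u).
Proof.
have [m _ _] : bmeas (fun W : T => expi u * power_trace k W).
  by apply: bmeasM; [exact: bmeas_cst|exact: bmeas_power_trace].
exact: (measurable_funM (@measurable_cst _ _ _ _ _ _) m).
Qed.

Lemma cos_stat_eigen k u (W : unitary R n) (t : 'I_n -> R) : is_eigenangles W t ->
  cos_stat k u W = n%:R^-1 * \sum_(j < n) cos (k%:R * t j + u).
Proof.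
move=> [_ Ec]; rewrite /cos_stat /power_trace (trace_exp_eigen k (unitary_mxP W) Ec).
rewrite mulr_sumr raddf_sum; congr (_ * _); apply: eq_bigr => j _ /=.
by rewrite expi_exp -expiD addrC.
Qed.

Lemma cos_stat0 u W : (0 < n)%N -> cos_stat 0 u W = cos u.
Proof.
move=> n0; rewrite /cos_stat /power_trace expr0 mxtrace1 mulrC [_ * n%:R]mulrC Re_natM.
by rewrite mulrAC mulfV ?mul1r// pnatr_eq0 -lt0n.
Qed.

Lemma sqr_cos_stat_le k u W :
  cos_stat k u W ^+ 2 <= n%:R^-1 ^+ 2 * Re (power_trace k W * (power_trace k W)^*).
Proof.
rewrite exprMn; apply: ler_wpM2l; first exact: sqr_ge0.
have : Re (expi u * power_trace k W * (expi u * power_trace k W)^*) = Re (power_trace k W * (power_trace k W)^*).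
  by apply: complexI; rewrite !Re_mulJ normrM norm_expi mul1r.
move=> <-; case: (_ * _) => a b /=; rewrite mulrN opprK lerDl; exact: sqr_ge0.
Qed.

Lemma measurable_trig_stat (I : finType) (c : I -> R) (k : I -> nat) (u : I -> R) :
  measurable_fun setT (fun W : T => \sum_x c x * cos_stat (k x) (u x) W).
Proof.
apply: measurable_sum => x.
exact: (measurable_funM (@measurable_cst _ _ _ _ _ _) (measurable_cos_stat _ _)).
Qed.

(** Markov's inequality for the square, after the Cauchy-Schwarz inequality has
    separated the frequencies. *)
Lemma deviation_prob (I : finType) (c : I -> R) (k : I -> nat) (u : I -> R) (a : R) :
  is_haar mu -> (0 < n)%N -> (forall x, (0 < k x)%N) -> 0 < a ->
  (mu [set W | a <= (\sum_x c x * cos_stat (k x) (u x) W) ^+ 2]%R <=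
    (a^-1 * (#|I|%:R * \sum_x c x ^+ 2 * 2 ^+ k x) * n%:R^-1 ^+ 2)%:E)%E.
Proof.
move=> Hmu n0 k0 a0.
pose G (W : T) : R[i] := \sum_x ((#|I|%:R * c x ^+ 2 * n%:R^-1 ^+ 2)%:C)%C *
  (power_trace (k x) W * (power_trace (k x) W)^*).
have bG : bmeas G.
  by apply: bmeas_sum => x; apply: bmeasM; [exact: bmeas_cst|exact: bmeas_moment].
have ReG W : Re (G W) = \sum_x (#|I|%:R * c x ^+ 2 * n%:R^-1 ^+ 2) * Re (power_trace (k x) W * (power_trace (k x) W)^*).
  by rewrite raddf_sum; apply: eq_bigr => x _; exact: Re_realM.
have G0 W : 0 <= Re (G W).
  rewrite ReG sumr_ge0// => x _; rewrite mulr_ge0 ?ge0_Re_mulJ// mulr_ge0 ?sqr_ge0//.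
  by rewrite mulr_ge0 ?sqr_ge0.
apply: le_trans (le_trans _ (expectC_markov mu bG G0 a0)) _.
  apply: le_measure.
  - by rewrite inE; apply/measurable_ge_set/measurable_funX; exact: measurable_trig_stat.
  - by rewrite inE; apply: measurable_ge_set; case: bG.
  - move=> W /= h; apply: le_trans h _; apply: le_trans (sqr_sum_le _) _.
    rewrite ReG mulr_sumr; apply: ler_sum => x _; rewrite exprMn -[leRHS]mulrA -[leRHS]mulrA.
    apply: ler_wpM2l; first exact: ler0n.
    apply: ler_wpM2l; first exact: sqr_ge0.
    exact: sqr_cos_stat_le.
rewrite lee_fin -mulrA ler_pM2l ?invr_gt0//.
have -> : Re (expectC mu G) = \sum_x (#|I|%:R * c x ^+ 2 * n%:R^-1 ^+ 2) * power_moment mu (k x).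
  rewrite /G expectC_sum => [|x]; last first.
    by apply: bmeasM; [exact: bmeas_cst|exact: bmeas_moment].
  rewrite raddf_sum; apply: eq_bigr => x _; rewrite expectCZ; last exact: bmeas_moment.
  exact: Re_realM.
rewrite mulr_sumr mulr_suml; apply: ler_sum => x _.
have -> : #|I|%:R * (c x ^+ 2 * 2 ^+ k x) * n%:R^-1 ^+ 2 =
    #|I|%:R * c x ^+ 2 * n%:R^-1 ^+ 2 * 2 ^+ k x by ring.
apply: ler_wpM2l; last exact: power_moment_le.
by rewrite mulr_ge0 ?sqr_ge0// mulr_ge0 ?sqr_ge0.
Qed.

End fixed_n.
End deviation.

(** * Linear statistics of continuous functions *)

Section linear_statistics.
Variable R : realType.

Lemma circle_fun_continuous (phi : R[i] -> R) : {within unit_circle, continuous phi} ->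
  continuous (fun t : R => phi (expi t)).
Proof.
move=> /subspace_continuousP cphi t A nA.
have ct : unit_circle (expi t) by exact: norm_expi.
have nB : nbhs (expi t) [set z | unit_circle z -> A (phi z)] := cphi (expi t) ct A nA.
have nC : nbhs t [set s : R | unit_circle (expi s) -> A (phi (expi s))] :=
  @expi_continuous R t _ nB.
by apply: (@filterS _ (nbhs t) (nbhs_filter t) _ _ _ nC) => s /= h; apply: h; exact: norm_expi.
Qed.

Definition trig_sum (I : finType) (c : I -> R) (k : I -> nat) (u : I -> R) (t : R) : R :=
  \sum_x c x * cos ((k x)%:R * t + u x).

Lemma sum_cos_continuous (I : Type) (r : seq I) (c : I -> R) (k : I -> nat) (u : I -> R) :
  continuous (fun t : R => \sum_(x <- r) c x * cos ((k x)%:R * t + u x)).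
Proof.
elim: r => [|x r IH].
  by under eq_fun do rewrite big_nil; move=> t; exact: cvg_cst.
under eq_fun do rewrite big_cons.
move=> t; apply: cvgD; last exact: IH.
by apply: cvgMr; exact: cos_affine_continuous.
Qed.

Lemma Rintegral_uniform_trig (I : finType) (c : I -> R) (k : I -> nat) (u : I -> R) :
  \int[uniform_circle]_(t in angles) trig_sum c k u t =
  \sum_(x | k x == 0%N) c x * cos (u x).
Proof.
have p0 : 0 < 2 * pi :> R by rewrite mulr_gt0 ?pi_gt0.
rewrite Rintegral_uniform; last exact: sum_cos_continuous.
have ic := @continuous_integrable_circle R.
rewrite /trig_sum [RHS]big_mkcond; elim: (index_enum I) => [|x r IH].
  under eq_Rintegral do rewrite big_nil.
  by rewrite Rintegral_cst// mul0r mulr0 big_nil.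
under eq_Rintegral do rewrite big_cons.
have i1 : lebesgue_measure.-integrable `[0, 2 * pi : R] (EFin \o (fun t => cos ((k x)%:R * t + u x))).
  by apply: ic; exact: cos_affine_continuous.
rewrite RintegralD//; last 2 first.
- by apply: ic => t; apply: cvgMr; exact: cos_affine_continuous.
- by apply: ic; exact: sum_cos_continuous.
rewrite mulrDr IH big_cons RintegralZl// Rintegral_cos; congr (_ + _).
case: eqP => _; last by rewrite !mulr0.
by rewrite mulrCA mulKf ?gt_eqF.
Qed.

Lemma dist_mean_le n (a b : 'I_n -> R) (e : R) : 0 <= e -> (forall j, `|a j - b j| <= e) ->
  `|n%:R^-1 * (\sum_j a j) - n%:R^-1 * (\sum_j b j)| <= e.
Proof.
move=> e0 ab; rewrite -mulrBr -sumrB normrM ger0_norm ?invr_ge0//.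
have [n0|n0] := eqVneq n 0%N.
  by have -> : n%:R^-1 = 0 :> R; rewrite ?mul0r// n0 invr0.
rewrite mulrC ler_pdivrMr ?ltr0n ?lt0n//; apply: le_trans (ler_norm_sum _ _ _) _.
apply: (@le_trans _ _ (\sum_(j < n) e)); first exact: ler_sum.
by rewrite sumr_const card_ord mulr_natr.
Qed.

Lemma trig_stat_eigen n (V : unitary R n) (t : 'I_n -> R) (I : finType) (c : I -> R)
    (k : I -> nat) (u : I -> R) : is_eigenangles V t ->
  n%:R^-1 * \sum_j trig_sum c k u (t j) = \sum_x c x * cos_stat (k x) (u x) V.
Proof.
move=> Vt; rewrite exchange_big mulr_sumr; apply: eq_bigr => x _.
by rewrite (cos_stat_eigen _ _ Vt) -mulr_sumr mulrCA.
Qed.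

End linear_statistics.

Lemma eigenangles_angles (R : realType) n (V : unitary R n) (t : 'I_n -> R) j :
  is_eigenangles V t -> (@angles R) (t j).
Proof. by move=> [h _]; rewrite /angles /= in_itv /= h. Qed.

(** The statistic is a pointwise limit of statistics of trigonometric polynomials,
    which are measurable functions of the matrix. *)
Lemma stat_measurable (R : realType) d (Omega : measurableType d) n
    (V : {mfun Omega >-> borel_unitary R n}) (t : Omega -> 'I_n -> R) (f : R -> R) :
  (forall w, is_eigenangles (V w) (t w)) ->
  continuous f -> (forall r s, expi r = expi s -> f r = f s) ->
  measurable_fun setT (fun w => n%:R^-1 * \sum_j f (t w j)).
Proof.
move=> Vt cf fper.
have H m : exists g : Omega -> R, measurable_fun setT g /\
   forall w, `|n%:R^-1 * (\sum_j f (t w j)) - g w| <= harmonic m.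
  have h0 : 0 < harmonic m :> R by rewrite /harmonic invr_gt0 ltr0n.
  have [I [c [k [u fq]]]] := trig_approx cf fper h0.
  exists (fun w => \sum_x c x * cos_stat (k x) (u x) (V w)); split.
    apply: measurable_sum => x; apply: measurable_funM; first exact: measurable_cst.
    apply: (measurableT_comp (@measurable_cos_stat R n (k x) (u x))).
    exact: measurable_funPT.
  move=> w; rewrite -(trig_stat_eigen _ _ _ (Vt w)); apply: dist_mean_le (ltW h0) _ => j.
  by apply: fq; have [] := Vt w.
have [g gP] := choice H.
apply: (@measurable_fun_cvg _ _ _ _ g) => [m|w _]; first by have [] := gP m.
apply/cvgrPdist_le => e e0.
have /cvgrPdist_le/(_ e e0) := @cvg_harmonic R; apply: filterS => m /=.
rewrite sub0r normrN => he; apply: le_trans he; apply: le_trans (ler_norm _).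
by have [_] := gP m.
Qed.

(** Splits the tolerance e: a quarter for each of the two errors of replacing the
    test function by a trigonometric polynomial, and half for the fluctuation. *)
Lemma sqr_deviation_ge (R : realType) (e x y l nu : R) : 0 < e ->
  e < `|x - nu| -> `|x - y| <= e / 4 -> `|nu - l| <= e / 4 ->
  (e / 2) ^+ 2 <= (y - l) ^+ 2.
Proof.
move=> e0 h hX hN.
rewrite -[leRHS]real_normK ?num_real// lerXn2r ?nnegrE//; first by lra.
have h1 := ler_distD y x nu; have := ler_distD l y nu.
rewrite (distrC l); lra.
Qed.

Unset Implicit Arguments.

Theorem theorem2p3 (R : realType) (d : measure_display)
    (Omega : measurableType d) (P : probability Omega R)
    (U : forall n : nat, {mfun Omega >-> borel_unitary R n})
    (theta : forall n : nat, Omega -> 'I_n -> R)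
    (U_haar : forall n : nat, is_haar (distribution P (U n)))
    (theta_eigen : forall (n : nat) (w : Omega),
      is_eigenangles (U n w) (theta n w)) :
  cvg_weakly_in_probability P
    (fun n w => counting_measure (theta n w)) uniform_circle.
Proof.
move=> phi /circle_fun_continuous; set f := fun t => phi (expi t) => cf.
have fper s t : expi s = expi t -> f s = f t by rewrite /f => ->.
have mf : measurable_fun (@angles R) f.
  apply: measurable_funTS; exact: continuous_measurable_fun.
have XE n w : \int[counting_measure (theta n w)]_(t in angles) f t =
    n%:R^-1 * \sum_j f (theta n w j).
  apply: Rintegral_counting => //; first exact: measurable_angles.
  by move=> j; exact: (eigenangles_angles _ (theta_eigen n w)).
split=> [n|e e0].
  under eq_fun do rewrite XE; exact: (stat_measurable (theta_eigen n)).
under eq_fun do under eq_set do rewrite XE.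
set nu := Rintegral _ _ _.
have e4 : 0 < e / 4 by lra.
have [I [c [k [u fq]]]] := trig_approx cf fper e4.
(* The frequency 0 contributes exactly its limit, so it gets coefficient 0; its
   frequency is moved to 1 only because the moment bound is for k > 0. *)
pose dl x := if k x == 0%N then 0 else c x.
pose k' x := maxn 1 (k x).
pose B n := [set W : borel_unitary R n |
  (e / 2) ^+ 2 <= (\sum_x dl x * cos_stat (k' x) (u x) W) ^+ 2].
have e22 : 0 < (e / 2) ^+ 2 by rewrite exprn_gt0//; lra.
pose K := ((e / 2) ^+ 2)^-1 * (#|I|%:R * \sum_x dl x ^+ 2 * 2 ^+ k' x).
have mB n : measurable (B n).
  apply: measurable_ge_set; apply: measurable_funX; exact: measurable_trig_stat.
have mA n : measurable [set w | e < `|n%:R^-1 * \sum_j f (theta n w j) - nu|].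
  apply: measurable_gt_set; apply: measurableT_comp => //.
  apply: measurable_funB; last exact: measurable_cst.
  exact: (stat_measurable (theta_eigen n)).
have PB n : (P [set w | e < `|n.+1%:R^-1 * \sum_j f (theta n.+1 w j) - nu|]%R <=
    (K * n.+1%:R^-1 ^+ 2)%:E)%E.
  have k'0 x : (0 < k' x)%N by rewrite /k' leq_max.
  pose mu : probability (borel_unitary R n.+1) R := distribution P (U n.+1).
  have hmu : is_haar mu := U_haar n.+1.
  have hB : (mu (B n.+1) <= (K * n.+1%:R^-1 ^+ 2)%:E)%E.
    by move: mu hmu => mu hmu; exact: deviation_prob.
  have muE (A : set (borel_unitary R n.+1)) : mu A = P (U n.+1 @^-1` A) by [].
  rewrite muE in hB; apply: le_trans hB.
  apply: le_measure; rewrite ?inE//.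
    by rewrite -[X in measurable X]setTI; exact: measurable_funPT.
  move=> w /= h.
  have hX := dist_mean_le (ltW e4) (fun j => fq (theta n.+1 w j) (proj1 (theta_eigen n.+1 w) j)).
  rewrite (trig_stat_eigen _ _ _ (theta_eigen n.+1 w)) in hX.
  have hN : `|nu - \sum_(x | k x == 0%N) c x * cos (u x)| <= e / 4.
    rewrite -Rintegral_uniform_trig; apply: dist_Rintegral_uniform => //.
    exact: sum_cos_continuous.
  have E : \sum_x c x * cos_stat (k x) (u x) (U n.+1 w) - \sum_(x | k x == 0%N) c x * cos (u x)
     = \sum_x dl x * cos_stat (k' x) (u x) (U n.+1 w).
    rewrite [X in _ - X]big_mkcond -sumrB; apply: eq_bigr => x _; rewrite /dl /k'.
    case: eqP => [->|/eqP kx0]; first by rewrite cos_stat0// subrr mul0r.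
    by rewrite subr0 (maxn_idPr _)// lt0n.
  rewrite /B /= -E.
  exact: (sqr_deviation_ge e0 h hX hN).
pose p n := P [set w | e < `|n%:R^-1 * \sum_j f (theta n w j) - nu|].
(* The bound is for n > 0, hence the shift. *)
suff : p n.+1 @[n --> \oo] --> 0%E by rewrite (cvg_shiftS p).
apply: (@squeeze_cvge _ _ _ _ (cst 0%E) _ (fun n => (K * n.+1%:R^-1 ^+ 2)%:E)).
- by apply: nearW => n; rewrite measure_ge0 PB.
- exact: cvg_cst.
- apply: cvg_EFin; first by apply: nearW.
  rewrite -(mulr0 K); apply: cvgMr; rewrite -(mulr0 0).
  have h := @cvg_harmonic R.
  exact: (cvgM h h).
Qed.
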